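(* Let $G$ be a group and let $T$ be a reduced cocompact $G$-tree which is not an ascending HNN-extension. Then $T$ is rigid if and only if, for any two oriented edges $e, f$ of $T$ with the same origin $v$ such that $G_e\subset G_f$, one of the following holds: (1) $e$ and $f$ are in the same $G_v$-orbit. (2) $e$ and $\bar f$ are in the same $G$-orbit, and $G_e=G_f$. (3) There is an edge $f'$ with origin $v$, in the same $G$-orbit as $\bar f$, such that $G_f=G_{f'}=G_v$. Furthermore, there are only three $G_v$-orbits of edges with origin $v$ (those of $e,f,f'$).
   Context: A $G$-tree is a simplicial tree on which the group $G$ acts by simplicial automorphisms without inversions; it is cocompact if the quotient graph is finite. $G$-trees are considered up to $G$-equivariant isomorphism. $G_v$ and $G_e$ denote the stabilizers of a vertex $v$ and of an edge $e$. If $e$ is an oriented edge, $\bar e$ denotes $e$ with the opposite orientation; orbits in the statement are orbits of oriented edges. Inclusions $\subset$ are not necessarily strict. Collapse move: given a $G$-tree, choose an edge $e=vu$ such that $v,u$ are in distinct $G$-orbits and $G_e=G_u$, and collapse each edge in the $G$-orbit of $e$ to a point. An expansion move is the opposite operation. A $G$-tree $T'$ is a deformation of a cocompact $G$-tree $T$ if it may be obtained from $T$ by a finite sequence of expansion and collapse moves; the deformation space of $T$ is the set of its deformations. (Equivalently, by a theorem of Forester, a cocompact $G$-tree $T'$ is in the deformation space of $T$ if and only if $T$ and $T'$ have the same elliptic subgroups, a subgroup being elliptic if it fixes a point in the tree.) A $G$-tree is reduced if no collapse move can be performed on it; equivalently, whenever an edge has the same stabilizer as one of its endpoints, both its endpoints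 are in the same $G$-orbit. A $G$-tree $T$ is rigid if it is reduced and it is the only reduced tree in its deformation space, up to $G$-equivariant isomorphism. A $G$-tree is (associated to) an ascending HNN-extension if its quotient graph of groups has exactly one vertex and one edge, and at least one of the two monomorphisms from the edge group to the vertex group is onto. *)

(* Defs.v *)
From Stdlib Require Import Relation_Operators.
From mathcomp Require Import all_boot all_classical.

Set Implicit Arguments.
Unset Strict Implicit.
Unset Printing Implicit Defensive.

Local Open Scope classical_set_scope.
Local Open Scope group_scope.

(** Graphs are taken in the sense of Serre: [edge] is the type of oriented
    edges, and a geometric edge is a pair {e, bar e}. *)
Record graph := Graph {
  vertex : Type;
  edge : Type;
  origin : edge -> vertex;
  bar : edge -> edge;
  barK : involutive bar;
  bar_neq : forall e, bar e <> e
}.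

Definition terminus (X : graph) (e : edge X) : vertex X := origin (bar e).

Fixpoint walk (X : graph) (x : vertex X) (s : seq (edge X)) (y : vertex X)
  : Prop :=
  match s with
  | [::] => x = y
  | e :: s' => origin e = x /\ walk (terminus e) s' y
  end.

Definition without_backtracking (X : graph) (s : seq (edge X)) : Prop :=
  forall s1 e f s2, s = s1 ++ [:: e, f & s2] -> f <> bar e.

Definition is_tree (X : graph) : Prop :=
  [/\ inhabited (vertex X),
      forall x y : vertex X, exists s, walk x s y &
      forall (x : vertex X) s,
        walk x s x -> without_backtracking s -> s = [::]].

Record gtree (G : groupType) := GTree {
  gtree_graph :> graph;
  gtree_tree : is_tree gtree_graph;
  vact : G -> vertex gtree_graph -> vertex gtree_graph;
  eact : G -> edge gtree_graph -> edge gtree_graph;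
  vact1 : forall x, vact 1 x = x;
  vactM : forall g h x, vact (g * h) x = vact g (vact h x);
  eact1 : forall e, eact 1 e = e;
  eactM : forall g h e, eact (g * h) e = eact g (eact h e);
  origin_eact : forall g e, origin (eact g e) = vact g (origin e);
  bar_eact : forall g e, bar (eact g e) = eact g (bar e);
  no_inversion : forall g e, eact g e <> bar e
}.

Section GTrees.
Variable G : groupType.
Implicit Types T : gtree G.

Definition vstab T (x : vertex T) : set G := [set g | vact g x = x].
Definition estab T (e : edge T) : set G := [set g | eact g e = e].

Definition vorbit T (x : vertex T) : set (vertex T) :=
  range (fun g : G => vact g x).
Definition eorbit T (e : edge T) : set (edge T) :=
  range (fun g : G => eact g e).

Definition local_orbit T (x : vertex T) (e : edge T) : set (edge T) :=
  [set eact g e | g in vstab x].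

Definition local_orbits T (x : vertex T) : set (set (edge T)) :=
  [set local_orbit x e | e in [set e | origin e = x]].

Definition cocompact T : Prop :=
  finite_set (range (@vorbit T)) /\ finite_set (range (@eorbit T)).

Definition gtree_iso T T' : Prop :=
  exists (phi : vertex T -> vertex T') (psi : edge T -> edge T'),
    [/\ bijective phi /\ bijective psi,
        forall g x, phi (vact g x) = vact g (phi x),
        forall g e, psi (eact g e) = eact g (psi e),
        forall e, origin (psi e) = phi (origin e) &
        forall e, bar (psi e) = psi (bar e)].

Definition collapsible T (e : edge T) : Prop :=
  vorbit (origin e) <> vorbit (terminus e) /\ estab e = vstab (terminus e).

Definition unoriented_orbit T (e : edge T) : set (edge T) :=
  eorbit e `|` eorbit (bar e).

Definition joined_in T (A : set (edge T)) (x y : vertex T) : Prop :=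
  exists f, [/\ A f, origin f = x & terminus f = y].

(** [T'] is, up to isomorphism, the quotient of [T] by collapsing every edge in
    the orbit of [e] to a point: [p] is the quotient map on vertices, and [q]
    sends an edge of [T'] to the unique edge of [T] lying over it. *)
Definition is_collapse T (e : edge T) T' : Prop :=
  exists (p : vertex T -> vertex T') (q : edge T' -> edge T),
    [/\ range p = setT,
        forall x y, p x = p y <->
          clos_refl_sym_trans _ (joined_in (unoriented_orbit e)) x y,
        injective q /\ range q = ~` unoriented_orbit e,
        (forall g x, p (vact g x) = vact g (p x)) /\
          (forall g e', q (eact g e') = eact g (q e')) &
        (forall e', origin e' = p (origin (q e'))) /\
          (forall e', q (bar e') = bar (q e'))].

Definition collapse_move T T' : Prop :=
  exists e : edge T, collapsible e /\ is_collapse e T'.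

Definition expansion_move T T' : Prop := collapse_move T' T.

(** Isomorphisms are allowed as steps because trees are considered up to
    equivariant isomorphism. *)
Definition deformation : gtree G -> gtree G -> Prop :=
  clos_refl_trans (gtree G) (fun T T' =>
    [\/ gtree_iso T T', expansion_move T T' | collapse_move T T']).

Definition reduced T : Prop := forall e : edge T, ~ collapsible e.

Definition rigid T : Prop :=
  reduced T /\ forall T', deformation T T' -> reduced T' -> gtree_iso T T'.

(** The quotient graph of groups is a loop at a single vertex, with vertex group
    [vstab v] and edge group [estab e]. Its two monomorphisms are the inclusion
    (at the origin of [e]) and [x |-> g x g^-1] (at the terminus of [e], which
    [g] moves to [v]). *)
Definition ascending_HNN T : Prop :=
  exists (v : vertex T) (e : edge T) (g : G),
    [/\ vorbit v = setT,
        unoriented_orbit e = setT,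
        origin e = v /\ vact g (terminus e) = v &
        estab e = vstab v \/ [set g * x * g^-1 | x in estab e] = vstab v].

End GTrees.

(* Main.v *)
(* If [S] collapses onto [T] and every fiber of the collapse contains a point
   fixed by its stabilizer (a [contraction]), then [S] is a deformation of
   [T], and [S] is isomorphic to [T] as soon as it is reduced. When [T] satisfies
   the condition of the theorem, the class of trees that contract onto [T] is
   stable under expansion moves, trivially, and under collapse moves: if an edge
   [e] of [S] that survives in [T] may be collapsed, then the condition says that
   so few edges hang beyond the endpoint of [e] in its fiber that [e] may be
   exchanged with an edge of that fiber without changing the quotient [T].

   Conversely, if [G_e] is contained in [G_f], then [e] may be slid over [f].
   The slid tree [T'] is distinguished from [T] by the parity of translation
   lengths when [e] is a loop in the quotient, and otherwise by the distance
   between the fixed subtrees of two vertex stabilizers. When [e] is a translate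
   of the opposite of [f] there is nothing to slide; if [G_e] is strictly
   smaller than [G_f], which is strictly smaller than [G_v], then [T] is
   replaced by a reduced tree with one more orbit of vertices. *)
From Stdlib Require Import Relation_Operators.
Require Import Defs.
From mathcomp Require Import all_boot all_classical.

Set Implicit Arguments.
Unset Strict Implicit.
Unset Printing Implicit Defensive.

Local Open Scope classical_set_scope.

(** A slide refutes rigidity only if the slid tree is again reduced. When the tree obtained from [e]
    and [f] is not, reducedness of [T] makes one of the two edges a loop of the quotient which,
    reversed and translated back to [v], has stabilizer [G_v]. Every edge at [v] may be slid over
    such an edge, so the other edge of the pair is slid over it instead. Excluding ascending
    HNN-extensions supplies a further edge to slide at [v] when [G_f = G_v] and [e] is a translate
    of [bar f]; cocompactness bounds the number of vertex orbits, so that an additional orbit can be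
    detected. New graphs are shown to be trees through their cohomology mod 2: functions on edges
    are easily corrected when an edge changes its origin, while reduced walks are not. *)

(** Serves to define maps on orbits by a formula in a group element [i]: typically [R i x] says that
    [x] is the translate by [i] of a fixed element, and compatibility is an inclusion of
    stabilizers. [d] is the value elsewhere. *)
Lemma extend_along (I D A : Type) (R : I -> D -> Prop) (m : I -> A) (d : D -> A) :
  (forall i j x, R i x -> R j x -> m i = m j) ->
  exists F : D -> A, (forall i x, R i x -> F x = m i) /\
                     (forall x, (forall i, ~ R i x) -> F x = d x).
Proof.
move=> compat.
exists (fun x => if pselect (exists i, R i x) is left H then m (sval (cid H)) else d x).
split=> [i x Rix|x nR]; case: pselect => //.
- by move=> H; case: cid => j Rjx; apply: compat Rjx Rix.
- by case; exists i.
- by move=> H; have [i /nR] := H.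
Qed.

(** * Geodesics in trees *)

Section Walks.
Variable X : graph.
Implicit Types (x y z : vertex X) (e f : edge X) (s : seq (edge X)).

Definition turns : rel (edge X) := fun e f => `[< f <> bar e >].

Definition bar_seq s := rev (map (@bar X) s).

Lemma terminus_bar e : terminus (bar e) = origin e.
Proof. by rewrite /terminus barK. Qed.

Lemma walk_cat x s1 s2 y :
  walk x (s1 ++ s2) y <-> exists z, walk x s1 z /\ walk z s2 y.
Proof.
elim: s1 x => [|e s1 IH] x /=.
  by split=> [w|[z [-> //]]]; exists x.
split=> [[<- /IH [z [w1 w2]]]|[z [[<- w1] w2]]]; first by exists z.
by split=> //; apply/IH; exists z.
Qed.

Lemma walk_rcons x s e y :
  walk x (rcons s e) y <-> walk x s (origin e) /\ y = terminus e.
Proof.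
rewrite -cats1 walk_cat; split=> [[z [w]]|[w ->]]; last by exists (origin e).
by case=> E <-; rewrite E.
Qed.

Lemma walk_bar_seq x s y : walk x s y -> walk y (bar_seq s) x.
Proof.
elim: s x => [|e s IH] x /=; [by move=> ->|case=> <- /IH w].
by rewrite /bar_seq /= rev_cons walk_rcons terminus_bar.
Qed.

Lemma walk_last x s y z : walk x s y -> walk x s z -> y = z.
Proof.
by elim: s x => [|e s IH] x /=; [move=> <-|case=> _ w1 [_ /(IH _ w1)]].
Qed.

Lemma reducedE s : without_backtracking s <-> sorted turns s.
Proof.
split=> [wb|st s1 e f s2 E].
  have {}wb s1 e f s2 : s = s1 ++ [:: e, f & s2] -> turns e f.
    by move=> /wb; move=> ne; apply/asboolP.
  case: s wb => // e s /=.
  elim: s e => // f s IH e wb /=; apply/andP; split; first exact: (wb [::] _ _ s).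
  by apply: IH => s1 e' f' s2 E; apply: (wb (e :: s1) _ _ s2); rewrite /= -E.
apply/asboolP; move: st; rewrite E sorted_cat_cons /= => /andP [_].
by case/andP.
Qed.

Lemma sorted_bar_seq s : sorted turns s -> sorted turns (bar_seq s).
Proof.
rewrite /bar_seq rev_sorted sorted_map; apply: sub_sorted => e f /asboolP ne.
by apply/asboolP; rewrite barK => E; apply: ne; rewrite E.
Qed.

Lemma sorted_rcons2 s e f :
  sorted turns (rcons (rcons s e) f) = sorted turns (rcons s e) && turns e f.
Proof.
by rewrite -(cats1 (rcons s e)) cat_rcons sorted_cat_cons /= andbT.
Qed.

Lemma sorted_join s1 s2 :
  sorted turns s1 -> sorted turns s2 ->
  (forall s1' e f s2', s1 = rcons s1' e -> s2 = f :: s2' -> f <> bar e) ->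
  sorted turns (s1 ++ s2).
Proof.
case: s2 => [|f s2]; first by rewrite cats0.
case: (lastP s1) => [//|{}s1 e] st1 st2 ne.
rewrite sorted_cat_cons sorted_rcons2 st1 /=.
by apply/andP; split; [apply/asboolP; apply: (ne s1 e f s2)|].
Qed.

(** Staying inside [A] while backtracking is cancelled makes subtrees convex: a geodesic never
    leaves a set of edges through which its ends are joined. *)
Lemma reduce_walk (A : set (edge X)) x s y :
  walk x s y -> all (fun e => `[< A e >]) s ->
  exists s', [/\ walk x s' y, sorted turns s' & all (fun e => `[< A e >]) s'].
Proof.
have [n] := ubnP (size s); elim: n s => // n IH s; rewrite ltnS => le_sn w As.
have [/reducedE st|] := pselect (without_backtracking s); first by exists s.
move=> /existsNP [s1 /existsNP [e /existsNP [f /existsNP [s2 /not_implyP [E]]]]].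
move=> /contrapT fE; move: le_sn w As; rewrite {}E {}fE.
rewrite size_cat /= !addnS => le_sn w As.
apply: (IH (s1 ++ s2)); first by rewrite size_cat; exact: leq_trans le_sn.
  move/walk_cat: w => [z [w1 /= [oe [_ w2]]]]; apply/walk_cat; exists z.
  by split=> //; move: w2; rewrite terminus_bar oe.
by move: As; rewrite !all_cat /= => /and4P [-> _ _ ->].
Qed.

Lemma clos_walk (A : set (edge X)) x y :
  (forall e, A e -> A (bar e)) ->
  clos_refl_sym_trans _
    (fun x y => exists f, [/\ A f, origin f = x & terminus f = y]) x y ->
  exists s, walk x s y /\ all (fun e => `[< A e >]) s.
Proof.
move=> Ab; elim=> {x y} [x y [f [Af <- <-]]|x|x y _ [s [w As]]|].
- by exists [:: f]; split=> //=; rewrite andbT; apply/asboolP.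
- by exists [::].
- exists (bar_seq s); split; first exact: walk_bar_seq.
  rewrite all_rev all_map; apply: sub_all As => e /= /asboolP Ae.
  by apply/asboolP; apply: Ab.
move=> x y z _ [s1 [w1 A1]] _ [s2 [w2 A2]]; exists (s1 ++ s2); split.
  by apply/walk_cat; exists y.
by rewrite all_cat A1.
Qed.

End Walks.

Section Trees.
Variables (X : graph) (tX : is_tree X).
Implicit Types (r x y z : vertex X) (e f : edge X) (s : seq (edge X)).

Lemma closed_reduced x s : walk x s x -> sorted (@turns X) s -> s = [::].
Proof. by case: tX => _ _ H w /reducedE; apply: H w. Qed.

Lemma reduced_walk_uniq x y s s' :
  walk x s y -> sorted (@turns X) s -> walk x s' y -> sorted (@turns X) s' ->
  s = s'.
Proof.
elim/last_ind: s s' y => [|s e IH] s' y.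
  by move=> /= <- _ w st; rewrite (closed_reduced w st).
case/lastP: s' => [w st /= E _|s' e' w st w' st'].
  by rewrite E in w *; rewrite (closed_reduced w st).
have [E|ne] := pselect (e = e').
  move: w w' st st'; rewrite {}E => /walk_rcons [w _] /walk_rcons [w' _].
  rewrite -!cats1 => /cat_sorted2 [st _] /cat_sorted2 [st' _].
  by rewrite (IH s' _ w st w' st').
have : rcons s e ++ bar_seq (rcons s' e') = [::].
  apply: (@closed_reduced x).
    by apply/walk_cat; exists y; split=> //; apply: walk_bar_seq.
  apply: sorted_join => //; first exact: sorted_bar_seq.
  move=> s1 e1 f s2 /rcons_inj [_ <-]; rewrite /bar_seq map_rcons rev_rcons.
  by case=> <- _ E; apply: ne; rewrite -(barK e) -E barK.
by case: (s).
Qed.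

Fact geod_subproof x y : exists s, walk x s y /\ sorted (@turns X) s.
Proof.
case: tX => _ cX _; have [s w] := cX x y.
have [|s' [w' st _]] := @reduce_walk X setT x s y w; last by exists s'.
by apply/allT => e; apply/asboolP.
Qed.

Definition geod x y := projT1 (cid (geod_subproof x y)).

Lemma geod_walk x y : walk x (geod x y) y.
Proof. by rewrite /geod; case: cid => s []. Qed.

Lemma geod_sorted x y : sorted (@turns X) (geod x y).
Proof. by rewrite /geod; case: cid => s []. Qed.

Lemma geod_uniq x y s : walk x s y -> sorted (@turns X) s -> geod x y = s.
Proof. by apply: reduced_walk_uniq; [exact: geod_walk|exact: geod_sorted]. Qed.

Lemma geod_inj r x y : geod r x = geod r y -> x = y.
Proof.
by move=> E; apply: (walk_last (geod_walk r x)); rewrite E; exact: geod_walk.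
Qed.

Lemma geodxx x : geod x x = [::].
Proof. exact: geod_uniq. Qed.

Lemma geod_nil r x : geod r x = [::] -> x = r.
Proof. by rewrite -(geodxx r) => /geod_inj. Qed.

Lemma geod_in (A : set (edge X)) x y s :
  walk x s y -> all (fun e => `[< A e >]) s ->
  all (fun e => `[< A e >]) (geod x y).
Proof.
by move=> w As; have [s' [w' st' A']] := reduce_walk w As; rewrite (geod_uniq w').
Qed.

Definition away r e := geod r (terminus e) = rcons (geod r (origin e)) e.

Lemma away_or r e : away r e \/ away r (bar e).
Proof.
case/lastP E: (geod r (origin e)) => [|s f].
  left; rewrite /away E; have oe := geod_nil E; apply: geod_uniq => //.
have [w' fE] : walk r s (origin f) /\ origin e = terminus f.
  by apply/walk_rcons; rewrite -E; apply: geod_walk.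
have [ef|ne] := pselect (e = bar f).
  right; rewrite /away terminus_bar E ef barK; congr rcons.
  apply/esym/geod_uniq => //.
  have := geod_sorted r (origin e); rewrite E -cats1.
  by case/cat_sorted2.
left; apply: geod_uniq; first by apply/walk_rcons; split=> //; apply: geod_walk.
rewrite E sorted_rcons2 -E geod_sorted /=.
by apply/asboolP.
Qed.

Lemma away_inj r e f : away r e -> away r f -> terminus e = terminus f -> e = f.
Proof. by rewrite /away => + + E; rewrite E => -> /rcons_inj [_ ->]. Qed.

Lemma ex_away r x : x <> r -> exists2 e, terminus e = x & away r e.
Proof.
case/lastP E: (geod r x) => [|s e]; first by rewrite (geod_nil E).
have [w tE] : walk r s (origin e) /\ x = terminus e.
  by apply/walk_rcons; rewrite -E; apply: geod_walk.
move=> _; exists e => //; rewrite /away -tE E; congr rcons.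
apply/esym/geod_uniq => //; have := geod_sorted r x; rewrite E -cats1.
by case/cat_sorted2.
Qed.

Definition dist r x := size (geod r x).

Lemma dist_away r e : away r e -> dist r (terminus e) = (dist r (origin e)).+1.
Proof. by rewrite /dist => ->; rewrite size_rcons. Qed.

Lemma away_asym r e : away r e -> ~ away r (bar e).
Proof.
move=> /dist_away + /dist_away; rewrite terminus_bar -/(terminus e) => ->.
by elim: (dist r (origin e)) => // n IH [/IH].
Qed.

(** [u] lies on the geodesic from [r] to [x]; in the tree rooted at [r], [x] descends from [u]. *)
Definition beyond r u x := exists s, geod r x = geod r u ++ s.

Lemma beyond_refl r u : beyond r u u.
Proof. by exists [::]; rewrite cats0. Qed.

Lemma beyond_dist r u x : beyond r u x -> (dist r u <= dist r x)%N.
Proof. by case=> s; rewrite /dist => ->; rewrite size_cat leq_addr. Qed.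

Lemma beyond_dist_eq r u x : beyond r u x -> (dist r x <= dist r u)%N -> x = u.
Proof.
case=> s E; rewrite /dist E size_cat => le.
have s0 : s = [::] by apply/nilP; rewrite /nilp -leqn0 -(leq_add2l (size (geod r u))) addn0.
by move: E; rewrite s0 cats0 => /geod_inj.
Qed.

Lemma beyond_trans r u y x : beyond r u y -> beyond r y x -> beyond r u x.
Proof. by case=> s E [s' E']; exists (s ++ s'); rewrite E' E catA. Qed.

Lemma dist_beyond r u x : beyond r u x -> dist r x = (dist r u + dist u x)%N.
Proof.
case=> s E; have := geod_walk r x; rewrite E => /walk_cat [z [w1 w2]].
rewrite -(walk_last (geod_walk r u) w1) in w2.
have := geod_sorted r x; rewrite E => /cat_sorted2 [_ st].
by rewrite /dist E size_cat (geod_uniq w2 st).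
Qed.

Lemma dist0 x y : dist x y = 0 -> y = x.
Proof. by rewrite /dist => /size0nil /geod_nil. Qed.

Lemma beyond_asym r u x : beyond r u x -> beyond u r x -> u = r.
Proof.
move=> /dist_beyond E /dist_beyond; rewrite E addnA => /eqP.
rewrite -{1}(add0n (dist u x)) eqn_add2r eq_sym addn_eq0 => /andP [_ /eqP].
by apply: dist0.
Qed.

Lemma beyond_away r u e : away r e ->
  beyond r u (terminus e) <-> beyond r u (origin e) \/ terminus e = u.
Proof.
move=> a; split=> [[s]|[[s E]|->]]; last exact: beyond_refl.
  rewrite a; case/lastP: s => [|s f].
    by rewrite cats0 -a => /geod_inj ->; right.
  by rewrite -rcons_cat => /rcons_inj [E _]; left; exists s.
by exists (rcons s e); rewrite a E rcons_cat.
Qed.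

Lemma beyond_root r u : beyond r u r -> u = r.
Proof.
by move=> b; symmetry; apply: (beyond_dist_eq b); rewrite /dist geodxx.
Qed.

Lemma beyond_same_dist r u u' x :
  beyond r u x -> beyond r u' x -> dist r u = dist r u' -> u = u'.
Proof.
move=> [s E] [s']; rewrite E => {}E eqd; apply: (@geod_inj r).
by have := congr1 (take (dist r u)) E; rewrite take_size_cat // take_size_cat.
Qed.

End Trees.

(** * Trees and cohomology mod 2 *)

Section Potentials.
Variable X : graph.
Implicit Types (x y z : vertex X) (e f : edge X) (s : seq (edge X)).

(** Every mod 2 cochain on geometric edges is a coboundary, so the first cohomology group mod 2
    vanishes. Among connected graphs this characterizes trees. *)
Definition has_potentials :=
  forall c : edge X -> bool, (forall e, c (bar e) = c e) ->
  exists phi : vertex X -> bool,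
    forall e, c e = phi (origin e) (+) phi (terminus e).

Lemma tree_potentials : is_tree X -> has_potentials.
Proof.
move=> tX c cb; have [[r] _ _] := tX.
exists (fun x => odd (count c (geod tX r x))) => e.
have odd_away f : away tX r f ->
    odd (count c (geod tX r (terminus f))) =
    c f (+) odd (count c (geod tX r (origin f))).
  by move=> ->; rewrite -cats1 count_cat /= addn0 oddD oddb addbC.
have [/odd_away ->|/odd_away] := away_or tX r e; first by rewrite addbCA addbb addbF.
by rewrite terminus_bar cb -/(terminus e) => ->; rewrite -addbA addbb addbF.
Qed.

(* Given the indicator function of a geometric edge, a potential cuts the graph
   along that edge: a reduced closed walk through it must come back through it,
   hence contains a shorter reduced closed walk. *)
Lemma potentials_tree :
  inhabited (vertex X) -> (forall x y, exists s, walk x s y) ->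
  has_potentials -> is_tree X.
Proof.
move=> iX cX pX; split=> // x s w /reducedE st.
have [n] := ubnP (size s); elim: n x s w st => // n IH x [//|e s] w st le_sn.
exfalso; pose c f := `[< f = e \/ f = bar e >].
have [|phi phiE] := pX c.
  move=> f; apply/asbool_equiv_eq; split=> [[]E|[->|->]].
  - by right; rewrite -E barK.
  - by left; apply: (can_inj (@barK X)).
  - by right.
  - by rewrite barK; left.
have c_e : c e by apply/asboolP; left.
move: w => /= [oe w].
(* A walk that avoids both orientations of [e] stays on one side of the cut. *)
have phi_walk t y z : walk y t z -> ~~ has c t -> phi y = phi z.
  elim: t y => [|f t IHt] y /=; first by move=> ->.
  case=> <- /IHt {}IHt; rewrite negb_or => /andP [nf /IHt <-].
  by move: (phiE f); rewrite (negPf nf); do 2!case: (phi _).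
have [hs|/(phi_walk _ _ _ w) E] := boolP (has c s); last first.
  by move: (phiE e); rewrite c_e E -oe addbb.
case: (split_find hs) w st le_sn => {hs} f s1 s2 /asboolP cf ncs1.
rewrite cat_rcons => /walk_cat [y [w1 [of_ _]]] st le_sn.
have /esym E := phi_walk _ _ _ w1 ncs1.
(* The first return to the cut starts from the side of [terminus e], so it is along [bar e]. *)
case: cf => fE; first by move: (phiE e); rewrite c_e -E -of_ fE addbb.
rewrite -of_ fE -/(terminus e) in w1.
move: (st); rewrite -cat_cons sorted_cat_cons => /andP [].
rewrite -cats1 => /cat_sorted2 [st1 _] _.
have {w1 st1 le_sn} s10 : s1 = [::].
  apply: IH w1 _ _; first by move: st1; case: (s1) => //= a s' /andP [].
  by move: le_sn; rewrite /= size_cat ltnS; apply: leq_trans; rewrite ltnS leq_addr.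
by move: st; rewrite s10 fE /= => /andP [/asboolP].
Qed.
End Potentials.

(** * Group actions on trees *)

Section Actions.
Local Open Scope group_scope.
Variables (G : groupType) (T : gtree G).
Implicit Types (g h : G) (x y r u : vertex T) (e f k : edge T).

Lemma vactK g x : vact g^-1 (vact g x) = x.
Proof. by rewrite -vactM mulVg vact1. Qed.

Lemma vactVK g x : vact g (vact g^-1 x) = x.
Proof. by rewrite -vactM mulgV vact1. Qed.

Lemma eactK g e : eact g^-1 (eact g e) = e.
Proof. by rewrite -eactM mulVg eact1. Qed.

Lemma eactVK g e : eact g (eact g^-1 e) = e.
Proof. by rewrite -eactM mulgV eact1. Qed.

Lemma vact_inj g : injective (@vact _ T g).
Proof. exact: can_inj (vactK g). Qed.

Lemma eact_inj g : injective (@eact _ T g).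
Proof. exact: can_inj (eactK g). Qed.

Lemma terminus_eact g e : terminus (eact g e) = vact g (terminus e).
Proof. by rewrite /terminus bar_eact origin_eact. Qed.

Lemma estab_origin e : estab e `<=` vstab (origin e).
Proof. by move=> g ge; rewrite /vstab /= -origin_eact ge. Qed.

Lemma estab_terminus e : estab e `<=` vstab (terminus e).
Proof. by move=> g ge; rewrite /vstab /= -terminus_eact ge. Qed.

Lemma estab_bar e : estab (bar e) = estab e.
Proof.
apply/seteqP; split=> g; rewrite /estab /= -bar_eact => E; last by rewrite E.
exact: (can_inj (@barK T)).
Qed.

Lemma vstabV x g : vstab x g -> vstab x g^-1.
Proof. by rewrite /vstab /= => E; rewrite -{1}E vactK. Qed.

Lemma vact_stab g h x : vact g x = vact h x <-> vstab x (h^-1 * g).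
Proof.
rewrite /vstab /= vactM; split=> [->|/(congr1 (vact h))]; first exact: vactK.
by rewrite vactVK.
Qed.

Lemma eact_stab g h e : eact g e = eact h e <-> estab e (h^-1 * g).
Proof.
rewrite /estab /= eactM; split=> [->|/(congr1 (eact h))]; first exact: eactK.
by rewrite eactVK.
Qed.

Lemma vstab_act g x h : vstab (vact g x) h <-> vstab x (g^-1 * h * g).
Proof. by rewrite /vstab /= -vactM vact_stab mulgA. Qed.

Lemma estab_act g e h : estab (eact g e) h <-> estab e (g^-1 * h * g).
Proof. by rewrite /estab /= -eactM eact_stab mulgA. Qed.

Lemma vorbit_eq x y : vorbit x = vorbit y <-> exists g, y = vact g x.
Proof.
split=> [E|[g ->]].
  have : vorbit y y by exists 1 => //; exact: vact1.
  by rewrite -E => -[g _ <-]; exists g.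
apply/seteqP; split=> _ [h _ <-]; rewrite /vorbit; last first.
  by exists (h * g) => //; rewrite vactM.
by exists (h * g^-1) => //; rewrite vactM vactK.
Qed.

Lemma eorbit_eq e f : eorbit e = eorbit f <-> exists g, f = eact g e.
Proof.
split=> [E|[g ->]].
  have : eorbit f f by exists 1 => //; exact: eact1.
  by rewrite -E => -[g _ <-]; exists g.
apply/seteqP; split=> _ [h _ <-]; rewrite /eorbit; last first.
  by exists (h * g) => //; rewrite eactM.
by exists (h * g^-1) => //; rewrite eactM eactK.
Qed.

Lemma eorbitP e f : eorbit e f <-> exists g, f = eact g e.
Proof. by split=> [[g _ <-]|[g ->]]; exists g. Qed.

Lemma local_orbit_eq x e f : origin e = x -> origin f = x ->
  local_orbit x e = local_orbit x f <-> exists g, f = eact g e.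
Proof.
move=> oe of_; split=> [E|[g fE]].
  have : local_orbit x f f by exists 1; [exact: vact1|exact: eact1].
  by rewrite -E => -[g _ <-]; exists g.
have gx : vact g x = x by rewrite -{1}oe -origin_eact -fE.
apply/seteqP; split=> _ [h hx <-].
  exists (h * g^-1); last by rewrite fE eactM eactK.
  by rewrite /vstab /= vactM (vstabV gx).
by exists (h * g); [rewrite /vstab /= vactM gx|rewrite fE eactM].
Qed.

Lemma unoriented_bar e f : unoriented_orbit e f -> unoriented_orbit e (bar f).
Proof.
case=> [/eorbitP [g ->]|/eorbitP [g ->]]; rewrite bar_eact ?barK.
  by right; apply/eorbitP; exists g.
by left; apply/eorbitP; exists g.
Qed.

Lemma unoriented_eact g e f :
  unoriented_orbit e f -> unoriented_orbit e (eact g f).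
Proof.
by case=> /eorbitP [h ->]; rewrite -eactM; [left|right]; apply/eorbitP; exists (g * h).
Qed.

Lemma unoriented_orbit_bar e : unoriented_orbit (bar e) = unoriented_orbit e.
Proof. by rewrite /unoriented_orbit barK setUC. Qed.

Lemma not_inverted g h e : eact g e <> eact h (bar e).
Proof.
by move=> /(congr1 (eact h^-1)); rewrite eactK -eactM => /no_inversion.
Qed.

Definition tT := gtree_tree T.

Lemma walk_act g x s y : walk x s y -> walk (vact g x) (map (eact g) s) (vact g y).
Proof.
elim: s x => [|e s IH] x /=; first by move=> ->.
by case=> <- /IH; rewrite terminus_eact origin_eact.
Qed.

Lemma geod_act g x y : geod tT (vact g x) (vact g y) = map (eact g) (geod tT x y).
Proof.
apply: geod_uniq; first exact/walk_act/geod_walk.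
rewrite sorted_map; apply: sub_sorted (geod_sorted tT x y) => e f /asboolP ne.
by apply/asboolP; rewrite bar_eact => /eact_inj.
Qed.

Lemma away_act g r e : away tT r e -> away tT (vact g r) (eact g e).
Proof.
by rewrite /away terminus_eact origin_eact !geod_act => ->; rewrite map_rcons.
Qed.

Lemma dist_act g x y : dist tT (vact g x) (vact g y) = dist tT x y.
Proof. by rewrite /dist geod_act size_map. Qed.

Lemma beyond_act g r u x :
  beyond tT r u x -> beyond tT (vact g r) (vact g u) (vact g x).
Proof.
by case=> s E; exists (map (eact g) s); rewrite !geod_act E map_cat.
Qed.

(** [g] sends [e] to an edge that points away from [r] and has the same terminus, and there is only
    one such edge. *)
Lemma fix_away g r e :
  away tT r e -> vstab r g -> vstab (terminus e) g -> estab e g.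
Proof.
move=> a gr ge; have ag := away_act g a; rewrite gr in ag.
by apply: (away_inj ag a); rewrite terminus_eact.
Qed.

Lemma fix_geod g x y :
  vstab x g -> vstab y g -> all (fun e => `[< estab e g >]) (geod tT x y).
Proof.
move=> gx gy; have := geod_act g x y; rewrite gx gy.
elim: (geod _ _ _) => //= e s IH [ge /IH ->]; rewrite andbT.
by apply/asboolP; rewrite /estab /= -ge.
Qed.

Lemma fix_beyond g r u x :
  beyond tT r u x -> vstab r g -> vstab x g -> vstab u g.
Proof.
move=> bux gr gx; have := beyond_act g bux; rewrite gr gx => bgux.
by apply: (beyond_same_dist bgux bux); rewrite -{1}gr dist_act.
Qed.

Lemma reducedP : reduced T <->
  forall e, vstab (terminus e) `<=` estab e -> exists g, terminus e = vact g (origin e).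
Proof.
split=> [rT e sub|rT e [ne E]].
  apply: contrapT => ne; apply: (rT e); split; first by rewrite vorbit_eq.
  by apply/seteqP; split=> //; exact: estab_terminus.
by apply/ne/vorbit_eq/rT; rewrite E.
Qed.

End Actions.

(** * Contractions and the exchange of edges *)

Section Contractions.
Local Open Scope group_scope.
Variable G : groupType.
Implicit Types S T : gtree G.

Definition linked T (A : set (edge T)) := clos_refl_sym_trans _ (joined_in A).

Lemma linked_edge T (A : set (edge T)) f : A f -> linked A (origin f) (terminus f).
Proof. by move=> Af; apply: rst_step; exists f. Qed.

Lemma linked_map S T (A : set (edge S)) (B : set (edge T)) (p : vertex S -> vertex T) :
  (forall f, A f -> linked B (p (origin f)) (p (terminus f))) ->
  forall x y, linked A x y -> linked B (p x) (p y).
Proof.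
move=> H x y; elim=> {x y} [x y [f [/H + <- <-]] //|x|x y _|x y z _ + _].
- exact: rst_refl.
- exact: rst_sym.
- exact: rst_trans.
Qed.

Lemma linked_eq T U (A : set (edge T)) (p : vertex T -> U) :
  (forall f, A f -> p (origin f) = p (terminus f)) ->
  forall x y, linked A x y -> p x = p y.
Proof. by move=> H x y; elim=> {x y} [x y [f [/H + <- <-]] //|//|//|x y z _ -> _ ->]. Qed.

(* [p] collapses every edge outside the range of [q] and [q e] is the edge
   lying over [e]. The last field says that the stabilizer of each fiber of [p]
   fixes a point of it, so that [S] and [T] have the same elliptic subgroups. *)
Record contraction S T (p : vertex S -> vertex T) (q : edge T -> edge S) : Prop :=
  Contraction {
    fiberP : forall x y, p x = p y <-> linked (~` range q) x y;
    edge_lift_inj : injective q;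
    proj_act : forall g x, p (vact g x) = vact g (p x);
    lift_act : forall g e, q (eact g e) = eact g (q e);
    origin_lift : forall e, origin e = p (origin (q e));
    lift_bar : forall e, q (bar e) = bar (q e);
    fiber_fix : forall b, exists2 y, p y = b & vstab b `<=` vstab y
  }.

Definition contracts S T := exists p q, @contraction S T p q.

Section Theory.
Variables (S T : gtree G) (p : vertex S -> vertex T) (q : edge T -> edge S).
Hypothesis pq : contraction p q.

Lemma range_bar f : range q (bar f) -> range q f.
Proof.
by case=> e _ E; exists (bar e) => //; rewrite (lift_bar pq) E barK.
Qed.

Lemma range_act g f : range q (eact g f) -> range q f.
Proof.
by case=> e _ E; exists (eact g^-1 e) => //; rewrite (lift_act pq) E eactK.
Qed.

Lemma terminus_lift e : terminus e = p (terminus (q e)).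
Proof. by rewrite /terminus (origin_lift pq) (lift_bar pq). Qed.

Lemma estab_lift e : estab (q e) = estab e.
Proof.
apply/seteqP; split=> g; rewrite /estab /= -(lift_act pq); last by move=> ->.
exact: (edge_lift_inj pq).
Qed.

Lemma vstab_proj x : vstab x `<=` vstab (p x).
Proof. by move=> g gx; rewrite /vstab /= -(proj_act pq) gx. Qed.

Lemma collapsed_edge f : ~ range q f -> p (origin f) = p (terminus f).
Proof. by move=> nf; apply/(fiberP pq)/linked_edge. Qed.

(** Fibers are subtrees: reducing a walk through collapsed edges uses no other edge. *)
Lemma fiber_geod x y : p x = p y -> all (fun f => `[< ~ range q f >]) (geod (tT S) x y).
Proof.
move/(fiberP pq)/clos_walk=> [|s [w As]]; last exact: geod_in As.
by move=> e ne /range_bar.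
Qed.

Lemma away_collapsed r e : away (tT S) r e -> p r = p (terminus e) ->
  ~ range q e /\ p (origin e) = p r.
Proof.
move=> a /[dup] E /fiber_geod; rewrite a all_rcons => /andP [/asboolP ne _].
by split=> //; rewrite E collapsed_edge.
Qed.

End Theory.

Lemma contracts_refl T : contracts T T.
Proof.
exists id, id; split=> //; last by move=> b; exists b.
move=> x y; split=> [->|]; first exact: rst_refl.
by apply: (linked_eq (p := id)) => f []; exists f.
Qed.

Lemma contraction_comp S S1 T p1 q1 p q :
  @contraction S S1 p1 q1 -> @contraction S1 T p q ->
  contraction (p \o p1) (q1 \o q).
Proof.
move=> c1 c; split=> /=.
- move=> x y; split.
    have [E|] := pselect (p1 x = p1 y).
      move=> _; have /(fiberP c1) := E; apply: (linked_map (p := id)) => f nf.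
      by apply: linked_edge => -[e _ E']; apply: nf; exists (q e).
    (* Through a section of [p1], an edge of [S1] collapsed by [p] lifts to a collapsed edge of [S],
       up to moves inside fibers of [p1]. *)
    have [s ps1 s1p] : exists2 s : vertex S1 -> vertex S,
        (forall z, p1 (s z) = z) & True.
      exists (fun z => sval (cid2 (fiber_fix c1 z))) => // z.
      by case: cid2.
    move=> _ /(fiberP c).
    have Lfib a b : p1 a = p1 b -> linked (~` range (q1 \o q)) a b.
      move/(fiberP c1); apply: (linked_map (p := id)) => f nf.
      by apply: linked_edge => -[e _ E']; apply: nf; exists (q e).
    move=> L; have : linked (~` range (q1 \o q)) (s (p1 x)) (s (p1 y)).
      move: L; apply: linked_map => f nf.
      apply: (rst_trans _ _ _ (origin (q1 f))).
        by apply: Lfib; rewrite ps1 (origin_lift c1).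
      apply: (rst_trans _ _ _ (terminus (q1 f))).
        by apply: linked_edge => -[e _ /(edge_lift_inj c1) E]; apply: nf; exists e.
      by apply: Lfib; rewrite ps1 (terminus_lift c1).
    move=> {}L; apply: (rst_trans _ _ _ (s (p1 x))); first by apply: Lfib.
    by apply: (rst_trans _ _ _ (s (p1 y))) => //; apply: Lfib.
  apply: (linked_eq (p := p \o p1)) => f nf /=.
  have [[e _ E]|] := pselect (range q1 f); last by move/(collapsed_edge c1) => ->.
  rewrite -E -(origin_lift c1) -(terminus_lift c1); apply: (collapsed_edge c).
  by move=> [e' _ E']; apply: nf; exists e' => //=; rewrite E'.
- by move=> e e' /(edge_lift_inj c1)/(edge_lift_inj c).
- by move=> g x; rewrite (proj_act c1) (proj_act c).
- by move=> g e; rewrite (lift_act c) (lift_act c1).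
- by move=> e; rewrite (origin_lift c) (origin_lift c1).
- by move=> e; rewrite (lift_bar c) (lift_bar c1).
move=> b; have [y yb by_] := fiber_fix c b; have [z zy' zy] := fiber_fix c1 y.
by exists z; [rewrite /= zy'|exact: subset_trans zy].
Qed.

Lemma contracts_trans S S1 T : contracts S S1 -> contracts S1 T -> contracts S T.
Proof.
move=> [p1 [q1 c1]] [p [q c]]; exists (p \o p1), (q1 \o q).
exact: contraction_comp c1 c.
Qed.

(** Edges collapsed by [p1] are collapsed by [p], so [p] is constant on the fibers of [p1] and
    factors through any section of it. *)
Lemma contracts_factor S S1 T p1 q1 p q :
  @contraction S S1 p1 q1 -> @contraction S T p q -> range q `<=` range q1 ->
  contracts S1 T.
Proof.
move=> c1 c sub.
have surj z : exists x, p1 x = z by have [x] := fiber_fix c1 z; exists x.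
pose s z := sval (cid (surj z)).
have ps z : p1 (s z) = z by rewrite /s; case: cid.
have lft e : exists e1, q1 e1 = q e.
  by have [|e1 _] := sub (q e); [exists e|exists e1].
pose q' e := sval (cid (lft e)).
have q1q' e : q1 (q' e) = q e by rewrite /q'; case: cid.
have fact a b : p1 a = p1 b -> p a = p b.
  move/(fiberP c1); apply: linked_eq => f nf; apply: (collapsed_edge c).
  by move/sub.
have psp x : p (s (p1 x)) = p x by apply: fact.
have rangeq' f1 : range q' f1 <-> range q (q1 f1).
  split=> [[e _ <-]|[e _]]; first by exists e.
  by rewrite -q1q' => /(edge_lift_inj c1) <-; exists e.
exists (p \o s), q'; split.
- move=> x y /=; split.
    rewrite -{2}(ps x) -{2}(ps y) => /(fiberP c).
    apply: (linked_map (p := p1)) => f nf.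
    have [[f1 _ E]|nf1] := pselect (range q1 f).
      rewrite -E -(origin_lift c1) -(terminus_lift c1); apply: linked_edge.
      by move/rangeq'; rewrite E.
    by rewrite (collapsed_edge c1) //; apply: rst_refl.
  apply: (linked_eq (p := p \o s)) => f nf /=.
  rewrite /= (origin_lift c1) (terminus_lift c1) !psp.
  by apply: (collapsed_edge c) => /rangeq'.
- by move=> e e' E; apply: (edge_lift_inj c); rewrite -!q1q' E.
- by move=> g x /=; rewrite -(proj_act c); apply: fact; rewrite ps (proj_act c1) ps.
- by move=> g e; apply: (edge_lift_inj c1); rewrite q1q' (lift_act c1) q1q' (lift_act c).
- by move=> e /=; rewrite (origin_lift c1) psp q1q' (origin_lift c).
- by move=> e; apply: (edge_lift_inj c1); rewrite q1q' (lift_bar c1) q1q' (lift_bar c).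
move=> b; have [y yb by_] := fiber_fix c b; exists (p1 y); first by rewrite /= psp.
exact: subset_trans (vstab_proj c1 (x := y)).
Qed.

Lemma iso_contracts S T : gtree_iso S T -> contracts T S.
Proof.
move=> [phi [psi [[[phi' phiK phi'K]]]]].
move=> [psi' psiK psi'K] phiA psiA opsi bpsi.
have phi'A g x : phi' (vact g x) = vact g (phi' x).
  by rewrite -{1}(phi'K x) -phiA phiK.
exists phi', psi; split=> //.
- move=> x y; split=> [/(can_inj phi'K) ->|]; first exact: rst_refl.
  by apply: linked_eq => f []; exists (psi' f).
- exact: can_inj psiK.
- by move=> e; rewrite opsi phiK.
move=> b; exists (phi b) => // g gb.
by rewrite /vstab /= -phiA gb.
Qed.

(** Orient a collapsed edge away from a point [b0] fixed by the stabilizer of its fiber. The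
    stabilizer of its terminus fixes [b0], hence the edge; its ends are at different distances from
    [b0], hence in different orbits. So the edge would be collapsible. *)
Lemma contraction_reduced_iso S T p q :
  @contraction S T p q -> reduced S -> gtree_iso T S.
Proof.
move=> c /reducedP rS.
have full f : range q f.
  apply: contrapT => nf.
  have [b0 pb0 fixb0] := fiber_fix c (p (origin f)).
  wlog {nf} a : f pb0 fixb0 nf / away (tT S) b0 f.
    move=> H; have [a|a] := away_or (tT S) b0 f; first exact: H a.
    apply: (H (bar f)) a => //; first by rewrite pb0 (collapsed_edge c).
      by rewrite -/(terminus f) -(collapsed_edge c).
    by move/(range_bar c).
  have pE := collapsed_edge c nf.
  have [|g gE] := rS f.
    move=> g gt; apply: (fix_away a) => //; apply: fixb0.
    by rewrite pE; apply: (vstab_proj c).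
  have gb0 : vstab b0 g.
    by apply: fixb0; rewrite /vstab /= -(proj_act c) -gE pE.
  have := dist_away a; rewrite gE -{1}gb0 dist_act.
  by elim: (dist _ _ _) => // n IH [].
have pinj : injective p.
  by move=> x y /(fiberP c); apply: (linked_eq (p := id)) => f [].
pose s z := sval (cid2 (fiber_fix c z)).
have ps z : p (s z) = z by rewrite /s; case: cid2.
have sp x : s (p x) = x by apply: pinj.
have lft e : exists e1, q e1 = e by have [e1] := full e; exists e1.
pose q' e := sval (cid (lft e)).
have qq' e : q (q' e) = e by rewrite /q'; case: cid.
exists s, q; split.
- split; first by exists p.
  by exists q' => // e; apply: (edge_lift_inj c).
- by move=> g x; apply: pinj; rewrite (proj_act c) !ps.
- exact: (lift_act c).
- by move=> e; apply: pinj; rewrite ps (origin_lift c).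
- by move=> e; rewrite (lift_bar c).
Qed.

Lemma collapse_contraction S T (e : edge S) :
  collapsible e -> is_collapse e T ->
  exists p q, @contraction S T p q /\ range q = ~` unoriented_orbit e.
Proof.
move=> [ne sE] [p [q [surj fib [qinj rq] [pA qA] [oq bq]]]].
exists p, q; split=> //; split=> //; first by move=> x y; rewrite fib rq setCK.
set u := terminus e; set v := origin e in ne sE *.
(* Each fiber of [p] is a star; [r] retracts it to its center. *)
have [|r [r_u r_other]] := @extend_along G _ _ (fun g x => x = vact g u)
    (fun g => vact g v) id.
  move=> g h x -> /vact_stab; rewrite -sE => /estab_origin gh.
  exact/vact_stab.
have nvu g h : vact g v <> vact h u.
  move=> E; apply/ne/vorbit_eq; exists (h^-1 * g).
  by rewrite vactM E vactK.
have {}r_u g : r (vact g u) = vact g v by apply: r_u.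
have r_v g : r (vact g v) = vact g v by apply: r_other => h; apply: nvu.
have r_fib x y : p x = p y -> r x = r y.
  move/fib; apply: linked_eq => f [/eorbitP [g ->]|/eorbitP [g ->]].
    by rewrite origin_eact terminus_eact r_u r_v.
  by rewrite origin_eact terminus_eact terminus_bar r_u r_v.
move=> b; have [x _ <-] : range p b by rewrite surj.
have [[g xE]|nx] := pselect (exists g, x = vact g u).
  have pE : p x = p (vact g v).
    apply/esym/fib; rewrite xE -origin_eact -terminus_eact; apply: linked_edge.
    by left; apply/eorbitP; exists g.
  exists (vact g v); first by [].
  move=> h; rewrite pE /vstab /= -pA => /r_fib; rewrite r_v.
  by rewrite -vactM r_v vactM.
exists x => // h; rewrite /vstab /= -pA => /r_fib.
rewrite !r_other // => [g E|g E]; apply: nx; first by exists g.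
by exists (h^-1 * g); rewrite vactM -E vactK.
Qed.

End Contractions.

Section Exchange.
Local Open Scope group_scope.
Variables (G : groupType) (S T : gtree G).
Variables (p : vertex S -> vertex T) (q : edge T -> edge S).
Hypothesis pq : contraction p q.
Variables (k : edge T) (r : vertex S).
Let u := origin (q k).
Hypothesis pr : p r = origin k.
Hypothesis fix_r : vstab (origin k) `<=` vstab r.
Hypothesis r_neq_u : r <> u.
Hypothesis fix_k : vstab u `<=` estab k.
Hypothesis only_k : forall h, origin h = origin k ->
  beyond (tT S) r u (origin (q h)) -> h = k.

(* Collapsing [q k] instead of the last edge [eps] of the path from [r] to
   [u] yields the same tree: the part of the fiber beyond [u] carries no other
   edge than [k], so it may be moved to the fiber at the other end of [k]. *)
Lemma contraction_exchange :
  exists p' q', @contraction G S T p' q' /\ ~ range q' (q k).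
Proof.
have [eps teps aeps] := @ex_away _ (tT S) r u (nesym r_neq_u).
have pu : p u = origin k by rewrite (origin_lift pq).
have [neps poeps] : ~ range q eps /\ p (origin eps) = p r.
  by apply: (away_collapsed pq aeps); rewrite teps pr.
have fix_eps : estab k `<=` estab eps.
  move=> g gk; apply: (fix_away aeps); first exact/fix_r/estab_origin.
  by rewrite teps; apply: estab_origin; rewrite (estab_lift pq).
have eps_fix : estab eps `<=` estab k.
  by move=> g /estab_terminus; rewrite teps => /fix_k.
(* [Z_g] is the part of the fiber over [g (origin k)] that lies beyond [g u] as seen from [g r]. *)
pose inZ g y := p y = vact g (origin k) /\ beyond (tT S) (vact g r) (vact g u) y.
have root_uniq g g' : vact g (origin k) = vact g' (origin k) -> vact g r = vact g' r.
  by move/vact_stab/fix_r/vact_stab.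
have inZ_act h g y : inZ g y -> inZ (h * g) (vact h y).
  move=> [E b]; split; first by rewrite (proj_act pq) E vactM.
  by rewrite !vactM; apply: beyond_act.
have inZ_uniq g g' y : inZ g y -> inZ g' y -> vact g u = vact g' u.
  move=> [E b] [E' b']; rewrite -(root_uniq g g') -?E -?E' // in b'.
  apply: (beyond_same_dist b b').
  by rewrite {2}(root_uniq g g') -?E -?E' // !dist_act.
have inZ_far g : inZ g (vact g u).
  by split; [rewrite (proj_act pq) pu|exact: beyond_refl].
have notZ_lift g h : inZ g (origin (q h)) -> h = eact g k.
  move=> /(inZ_act g^-1); rewrite mulVg => -[]; rewrite -origin_eact -(lift_act pq).
  rewrite -(origin_lift pq) !vact1 => E b.
  by rewrite -(only_k E b) eactVK.
(* [Z_g] joins the fiber at the other end of [g k]. If it meets [Z_h], then [g u = h u], and since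
   the stabilizer of [u] fixes [k] this end is the same for both. *)
have [|p' [p'_in p'_out]] := @extend_along G _ _ inZ (fun g => vact g (terminus k)) p.
  move=> g h y gy hy; apply/vact_stab/estab_terminus/fix_k/vact_stab.
  exact: inZ_uniq gy hy.
(* In the new lift [g k] is represented by [g eps]: [k] and [eps] have the same stabilizer, which
   makes this well defined and injective. The two orientations are treated in turn. *)
have [|q1 [q1_kb q1_other]] := @extend_along G _ _ (fun g h => h = eact g (bar k))
    (fun g => eact g (bar eps)) q.
  move=> g g' h -> /eact_stab; rewrite estab_bar => /fix_eps.
  by rewrite -estab_bar => /eact_stab.
have [|q' [q'_k q'_other]] := @extend_along G _ _ (fun g h => h = eact g k)
    (fun g => eact g eps) q1.
  by move=> g g' h -> /eact_stab/fix_eps/eact_stab.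
have {}q'_k g : q' (eact g k) = eact g eps by apply: q'_k.
have q'_kb g : q' (eact g (bar k)) = eact g (bar eps).
  by rewrite q'_other; [apply: q1_kb|move=> h /esym/not_inverted].
have {q1_kb q1_other}q'_other h : ~ unoriented_orbit k h -> q' h = q h.
  move=> nh; rewrite q'_other ?q1_other // => g E; apply: nh; [right|left];
    by apply/eorbitP; exists g.
have kcase h : [\/ exists g, h = eact g k, exists g, h = eact g (bar k)
                 | ~ unoriented_orbit k h].
  have [[/eorbitP|/eorbitP]|] := pselect (unoriented_orbit k h).
  - exact: Or31.
  - exact: Or32.
  - exact: Or33.
have inZ_root h g y : inZ h y -> p y = vact g (origin k) ->
    vact h r = vact g r /\ beyond (tT S) (vact g r) (vact h u) y.
  move=> [E b] E'; have R : vact h r = vact g r.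
    by apply: root_uniq; rewrite -E -E'.
  by rewrite -R.
have eps_away f g : unoriented_orbit eps f -> p (origin f) = vact g (origin k) ->
    away (tT S) (vact g r) f ->
    exists h, f = eact h eps /\ vact h (origin k) = vact g (origin k).
  move=> ef pf af.
  have [[h fE]|[h fE]] : (exists h, f = eact h eps) \/ exists h, f = eact h (bar eps).
  - by case: ef => /eorbitP; [left|right].
  - by exists h; split=> //; rewrite -pf fE origin_eact (proj_act pq) poeps pr.
  have E : vact h (origin k) = vact g (origin k).
    by rewrite -pf fE origin_eact -/(terminus eps) (proj_act pq) teps pu.
  have := away_act h aeps; rewrite (root_uniq _ _ E) => /away_asym; case.
  by rewrite bar_eact -fE.
(* Inside a fiber, the sets [Z_h] can be entered or left only through translates of [eps]. *)
have inZ_step f g h : ~ range q f -> ~ unoriented_orbit eps f ->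
    away (tT S) (vact g r) f -> p (origin f) = vact g (origin k) ->
    inZ h (origin f) <-> inZ h (terminus f).
  move=> nf nef af pf; have pf' := pf; rewrite (collapsed_edge pq nf) in pf'.
  split=> [z|z].
    have [R b] := inZ_root _ _ _ z pf; split; first by rewrite pf' -pf; case: z.
    by rewrite R; apply/(beyond_away _ af); left.
  have [R b] := inZ_root _ _ _ z pf'; split; first by rewrite pf -pf'; case: z.
  rewrite R; move/(beyond_away _ af): b => [//|tf]; case: nef; left; apply/eorbitP.
  exists h; apply: (away_inj af); first by rewrite -R; apply: away_act.
  by rewrite terminus_eact teps.
have not_range f : ~ range q' f ->
    unoriented_orbit (q k) f \/ ~ range q f /\ ~ unoriented_orbit eps f.
  move=> nf; have nef : ~ unoriented_orbit eps f.
    case=> /eorbitP [g E]; apply: nf; rewrite E.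
      by rewrite -q'_k; exists (eact g k).
    by rewrite -q'_kb; exists (eact g (bar k)).
  have [[h _ E]|] := pselect (range q f); last by right.
  left; rewrite -E; case: (kcase h) => [[g ->]|[g ->]|nh].
  - by rewrite (lift_act pq); left; apply/eorbitP; exists g.
  - by rewrite (lift_act pq) (lift_bar pq); right; apply/eorbitP; exists g.
  - by case: nf; exists h => //; rewrite q'_other.
have in_range f : range q' f ->
    (range q f /\ ~ unoriented_orbit (q k) f) \/ unoriented_orbit eps f.
  case=> h _ <-; case: (kcase h) => [[g ->]|[g ->]|nh].
  - by right; rewrite q'_k; left; apply/eorbitP; exists g.
  - by right; rewrite q'_kb; right; apply/eorbitP; exists g.
  left; rewrite q'_other //; split; first by exists h.
  case=> /eorbitP [g]; rewrite -?(lift_bar pq) -(lift_act pq) => /(edge_lift_inj pq) E; apply: nh.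
    by left; apply/eorbitP; exists g.
  by right; apply/eorbitP; exists g.
have notZ_end g h : ~ inZ h (vact g (terminus (q k))).
  rewrite -terminus_eact -(lift_act pq) /terminus -(lift_bar pq) => /notZ_lift.
  by rewrite bar_eact => /esym /not_inverted.
have p'_end g : p' (vact g (terminus (q k))) = vact g (terminus k).
  by rewrite p'_out // (proj_act pq) -(terminus_lift pq).
have p'_edge f : ~ range q' f -> p' (origin f) = p' (terminus f).
  case/not_range => [[|]/eorbitP [g ->]|[nf nef]].
  - rewrite origin_eact terminus_eact p'_end.
    exact: p'_in.
  - rewrite origin_eact terminus_eact terminus_bar -/(terminus _) p'_end.
    by rewrite (p'_in g).
  have pE := collapsed_edge pq nf.
  have [[g pf]|npf] := pselect (exists g, p (origin f) = vact g (origin k)); last first.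
    by rewrite !p'_out // => h [E _]; apply: npf; exists h => //; rewrite pE.
  wlog af : f nf nef pE pf / away (tT S) (vact g r) f.
    move=> H; have [a|a] := away_or (tT S) (vact g r) f; first exact: H.
    rewrite -(terminus_bar f); apply/esym/H => //.
    - by move/(range_bar pq).
    - by move/unoriented_bar; rewrite barK.
    - by rewrite terminus_bar.
    - by rewrite -/(terminus f) -pE.
  have [[h z]|nz] := pselect (exists h, inZ h (origin f)).
    have /(inZ_step _ _ _ nf nef af pf) z' := z.
    by rewrite (p'_in _ _ z) (p'_in _ _ z').
  rewrite !p'_out // => h z; apply: nz; exists h => //.
  exact/(inZ_step _ _ _ nf nef af pf).
have link_far g y : inZ g y -> linked (~` range q') (vact g u) y.
  have [n] := ubnP (dist (tT S) (vact g r) y).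
  elim: n y => // n IH y; rewrite ltnS => le_yn z.
  have [<-|yu] := pselect (y = vact g u); first exact: rst_refl.
  have [E b] := z.
  have [yr|yr] := pselect (y = vact g r).
    by case: yu; rewrite yr in b *; rewrite (beyond_root b).
  have [f tf af] := ex_away (tT S) yr.
  have [nf pf] : ~ range q f /\ p (origin f) = p (vact g r).
    by apply: (away_collapsed pq af); rewrite tf E (proj_act pq) pr.
  rewrite (proj_act pq) pr in pf.
  have nef : ~ unoriented_orbit eps f.
    move=> ef; have [h [fE hg]] := eps_away _ _ ef pf af.
    apply: yu; apply: (beyond_dist_eq b).
    by rewrite -tf fE terminus_eact teps -{1}(root_uniq _ _ hg) !dist_act.
  rewrite -tf; apply: (rst_trans _ _ _ (origin f)).
    apply: IH; last by apply/(inZ_step _ _ _ nf nef af pf); rewrite tf.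
    by move: le_yn; rewrite -tf (dist_away af); apply.
  by apply: linked_edge => /in_range [[]|].
have link_near g y : p y = vact g (origin k) -> (forall h, ~ inZ h y) ->
    linked (~` range q') (vact g r) y.
  have [n] := ubnP (dist (tT S) (vact g r) y).
  elim: n y => // n IH y; rewrite ltnS => le_yn E nz.
  have [<-|yr] := pselect (y = vact g r); first exact: rst_refl.
  have [f tf af] := ex_away (tT S) yr.
  have [nf pf] : ~ range q f /\ p (origin f) = p (vact g r).
    by apply: (away_collapsed pq af); rewrite tf E (proj_act pq) pr.
  rewrite (proj_act pq) pr in pf.
  have nef : ~ unoriented_orbit eps f.
    move=> ef; have [h [fE hg]] := eps_away _ _ ef pf af; apply: (nz h).
    by rewrite -tf fE terminus_eact teps.
  rewrite -tf; apply: (rst_trans _ _ _ (origin f)).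
    apply: IH => //; last first.
      by move=> h /(inZ_step _ _ _ nf nef af pf); rewrite tf; apply: nz.
    by move: le_yn; rewrite -tf (dist_away af); apply.
  by apply: linked_edge => /in_range [[]|].
have link_other x y : linked (~` range q) x y ->
    (forall g, p x <> vact g (origin k)) -> linked (~` range q') x y.
  elim=> {x y} [x y [f [nf <- <-]]|x|x y L IH npy|x y z L IH _ IH2 np].
  - move=> np; apply: linked_edge => /in_range [[//]|[|]/eorbitP [g fE]];
      apply: (np g); rewrite fE origin_eact (proj_act pq).
      by rewrite poeps pr.
    by rewrite -/(terminus eps) teps pu.
  - by move=> _; apply: rst_refl.
  - by apply/rst_sym/IH => g; rewrite ((fiberP pq _ _).2 L).
  - apply: (rst_trans _ _ _ y); first exact: IH.
    by apply: IH2 => g; rewrite -((fiberP pq _ _).2 L).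
(* A vertex of [Z_g] is joined, through [g u] and the now collapsed edge [g (q k)], to a vertex
   outside all these sets, where [p'] agrees with [p]. *)
have to_near x : exists x0, [/\ linked (~` range q') x x0, forall h, ~ inZ h x0
                               & p' x = p x0].
  have [[g z]|nz] := pselect (exists g, inZ g x); last first.
    exists x; split; [exact: rst_refl|by move=> h z; apply: nz; exists h|].
    by apply: p'_out => h z; apply: nz; exists h.
  exists (vact g (terminus (q k))); split=> //.
    apply: (rst_trans _ _ _ (vact g u)); first exact/rst_sym/link_far.
    rewrite -origin_eact -terminus_eact; apply: linked_edge => /in_range [[_]|ek].
      by apply; left; apply/eorbitP; exists g.
    case: neps; case: ek => /eorbitP [h E].
      apply: (range_act pq (g := h)); rewrite -E -(lift_act pq).
      by exists (eact g k).
    apply: (range_bar pq); apply: (range_act pq (g := h)).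
    by rewrite -E -(lift_act pq); exists (eact g k).
  by rewrite (p'_in _ _ z) (proj_act pq) -(terminus_lift pq).
have p'_root g : p' (vact g r) = vact g (origin k).
  rewrite p'_out; first by rewrite (proj_act pq) pr.
  move=> h z; have [|R b] := inZ_root _ g _ z; first by rewrite (proj_act pq) pr.
  by apply: r_neq_u; apply: (vact_inj (g := h)); rewrite R (beyond_root b).
exists p', q'; split; last first.
  case/in_range=> [[_]|]; first by apply; left; apply/eorbitP; exists 1; rewrite eact1.
  case=> /eorbitP [g E]; apply: neps; last apply: (range_bar pq);
    by apply: (range_act pq (g := g)); rewrite -E; exists k.
split.
- move=> x y; split; last exact: linked_eq.
  have [x0 [Lx nx ->]] := to_near x; have [y0 [Ly ny ->]] := to_near y.
  move=> E; apply: (rst_trans _ _ _ x0) => //; apply: (rst_trans _ _ _ y0); last first.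
    exact: rst_sym.
  have [[g px]|np] := pselect (exists g, p x0 = vact g (origin k)); last first.
    apply: link_other; first exact/(fiberP pq).
    by move=> g px; apply: np; exists g.
  apply: (rst_trans _ _ _ (vact g r)); first by apply/rst_sym/link_near.
  by apply: link_near; rewrite -?E.
- move=> h h'; case: (kcase h) => [[g ->]|[g ->]|nh]; case: (kcase h') => [[g' ->]|[g' ->]|nh'];
    rewrite ?q'_k ?q'_kb ?q'_other //.
  + by move/eact_stab/eps_fix/eact_stab.
  + by move/not_inverted.
  + move=> E; case: neps; apply: (range_act pq (g := g)); by rewrite E; exists h'.
  + by move/esym/not_inverted.
  + by move/eact_stab; rewrite estab_bar => /eps_fix; rewrite -estab_bar => /eact_stab.
  + move=> E; case: neps; apply: (range_bar pq); apply: (range_act pq (g := g)); by rewrite E; exists h'.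
  + move=> E; case: neps; apply: (range_act pq (g := g')); by rewrite -E; exists h.
  + move=> E; case: neps; apply: (range_bar pq); apply: (range_act pq (g := g')); by rewrite -E; exists h.
  + exact: (edge_lift_inj pq).
- move=> g x; have [[h z]|nz] := pselect (exists h, inZ h x).
    by rewrite (p'_in _ _ z) (p'_in _ _ (inZ_act g _ _ z)) vactM.
  rewrite !p'_out ?(proj_act pq) // => h z; apply: nz; first by exists h.
  by exists (g^-1 * h); rewrite -(vactK g x); apply: inZ_act.
- move=> g h; case: (kcase h) => [[g' ->]|[g' ->]|nh].
  + by rewrite -eactM !q'_k eactM.
  + by rewrite -eactM !q'_kb eactM.
  + rewrite !q'_other ?(lift_act pq) // => /(unoriented_eact g^-1).
    by rewrite eactK.
- move=> h; case: (kcase h) => [[g ->]|[g ->]|nh].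
  + rewrite q'_k !origin_eact p'_out; first by rewrite (proj_act pq) poeps pr.
    move=> g' z; have [|R b] := inZ_root _ g _ z.
      by rewrite (proj_act pq) poeps pr.
    have := beyond_dist b; rewrite -{1}R !dist_act.
    by rewrite -teps (dist_away aeps) ltnn.
  + rewrite q'_kb !origin_eact -/(terminus eps) teps -/(terminus k).
    by rewrite (p'_in g).
  + rewrite q'_other // p'_out; first exact: (origin_lift pq).
    by move=> g /notZ_lift E; apply: nh; left; apply/eorbitP; exists g.
- move=> h; case: (kcase h) => [[g ->]|[g ->]|nh].
  + by rewrite q'_k !bar_eact q'_kb.
  + by rewrite q'_kb !bar_eact !barK q'_k.
  + rewrite !q'_other ?(lift_bar pq) // => /unoriented_bar.
    by rewrite barK.
move=> b; have [[g ->]|nb] := pselect (exists g, b = vact g (origin k)).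
  exists (vact g r); first exact: p'_root.
  by move=> h /vstab_act/fix_r/vstab_act.
have [y py fy] := fiber_fix pq b; exists y => //.
by rewrite p'_out // => g [E _]; apply: nb; exists g; rewrite -py.
Qed.
End Exchange.

(** * Stability of contractions under collapse moves *)

Section Rigidity.
Local Open Scope group_scope.
Variable G : groupType.
Implicit Types S T : gtree G.

Definition rigidity_condition T :=
  forall (v : vertex T) (e f : edge T),
    origin e = v -> origin f = v -> estab e `<=` estab f ->
    [\/ local_orbit v e = local_orbit v f,
        eorbit e = eorbit (bar f) /\ estab e = estab f
      | exists f' : edge T,
          [/\ origin f' = v,
              eorbit f' = eorbit (bar f),
              estab f = estab f' /\ estab f' = vstab v,
              local_orbits v =
                [set local_orbit v e; local_orbit v f; local_orbit v f'] &
              (local_orbits v #= `I_3)%card]].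

Section Exchanges.
Variables (S T : gtree G) (p : vertex S -> vertex T) (q : edge T -> edge S).
Hypothesis pq : contraction p q.
Variable k : edge T.
Let b := origin k.
Let u := origin (q k).
Hypothesis fix_k : vstab u `<=` estab k.
Hypothesis not_loop : forall g, vact g (terminus (q k)) <> u.

Let exchangeable := exists p' q', @contraction G S T p' q' /\ ~ range q' (q k).

Let exchangeable_orbit h g : h = eact g (bar k) ->
  (exists p' q', @contraction G S T p' q' /\ ~ range q' (q h)) -> exchangeable.
Proof.
move=> hE [p' [q' [c nh]]]; exists p', q'; split=> // -[k' _ E]; apply: nh.
exists (eact g (bar k')) => //.
by rewrite hE (lift_act c) (lift_bar c) E (lift_act pq) (lift_bar pq).
Qed.

Let fix_b g x : p x = b -> vstab x g -> vstab b g.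
Proof. by move=> <-; apply: (vstab_proj pq). Qed.

(** The origins [u] of [q k] and [U] of [q k'] are both fixed by [vstab b]. Unless [u] lies between
    [U] and [origin (q h)], [k] is exchanged with root [U]. Otherwise [U] does not lie between [u]
    and that origin, and [k'], a translate of [bar k], is exchanged with root [u]. *)
Lemma exchange_three (h k' : edge T) :
  origin k' = b -> eorbit k' = eorbit (bar k) -> estab k = vstab b ->
  estab k' = vstab b ->
  (forall h', origin h' = b -> 
    [\/ exists g, h' = eact g h, exists g, h' = eact g k | exists g, h' = eact g k']) ->
  origin h = b -> exchangeable.
Proof.
move=> ok' /esym/eorbit_eq [g k'E] sk sk' three oh.
pose U := origin (q k').
have UE : U = vact g (terminus (q k)).
  by rewrite /U k'E (lift_act pq) (lift_bar pq) origin_eact.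
have nUu : U <> u by rewrite UE.
have pu : p u = b by rewrite /u -(origin_lift pq).
have pU : p U = b by rewrite /U -(origin_lift pq).
have fix_u : vstab b `<=` vstab u.
  by rewrite -sk -(estab_lift pq); apply: estab_origin.
have fix_U : vstab b `<=` vstab U.
  by rewrite -sk' -(estab_lift pq); apply: estab_origin.
have fixb h' c : origin h' = b -> origin (eact c h') = b -> vstab b c.
  by rewrite origin_eact => ->.
have [byd|nbyd] := pselect (beyond (tT S) U u (origin (q h))); last first.
  apply: (@contraction_exchange _ _ _ _ _ pq k U) => //.
  move=> h' oh' byd; have [[c E]|[c E]|[c E]] := three h' oh'.
  - case: nbyd; have cb : vstab b c by apply: (fixb h); rewrite -?E.
    have := beyond_act c^-1 byd.
    rewrite (fix_U _ (vstabV cb)) (fix_u _ (vstabV cb)) E (lift_act pq).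
    by rewrite origin_eact vactK.
  - have : vstab b c by apply: (fixb k); rewrite -?E.
    by rewrite -sk E => ->.
  - have : vstab b c by apply: (fixb k'); rewrite -?E.
    rewrite -sk' => ck'; move: byd; rewrite E ck' => /beyond_root E'.
    by case: nUu.
apply: (exchangeable_orbit k'E).
apply: (@contraction_exchange _ _ _ _ _ pq k' u); rewrite ?ok' ?sk' //.
- exact: nesym.
- by move=> c; apply: fix_b.
move=> h' oh' byd'; have [[c E]|[c E]|[c E]] := three h' oh'.
- have cb : vstab b c by apply: (fixb h); rewrite -?E.
  have := beyond_act c^-1 byd'; rewrite E (lift_act pq) origin_eact vactK.
  rewrite (fix_u _ (vstabV cb)) [vact _ (origin (q k'))](fix_U _ (vstabV cb)).
  by move=> /(beyond_asym byd)/nesym.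
- have : vstab b c by apply: (fixb k); rewrite -?E.
  rewrite -sk => ck; move: byd'; rewrite E ck => /beyond_root E'.
  by case: nUu.
- have : vstab b c by apply: (fixb k'); rewrite -?E.
  by rewrite -sk' E => ->.
Qed.

Hypothesis rT : reduced T.
Hypothesis cT : rigidity_condition T.

Let exchange_or h : origin h = b -> estab h `<=` estab k ->
  [\/ exists g, h = eact g k,
      (exists g, h = eact g (bar k)) /\ estab h = estab k | exchangeable].
Proof.
move=> oh sub; have [E|[E sE]|] := cT oh (erefl b) sub.
- by apply: Or31; apply/(local_orbit_eq (erefl b) oh).
- by apply: Or32; split=> //; apply/eorbit_eq.
case=> k' [ok' Ek' [sk sk'] three _]; apply: Or33.
apply: (@exchange_three h k') => //; first by rewrite sk.
move=> h' oh'; have : local_orbits b (local_orbit b h') by exists h'.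
rewrite three => -[[]|] /esym/local_orbit_eq-/(_ _ oh').
- by move=> /(_ oh); apply: Or31.
- by move=> /(_ (erefl b)); apply: Or32.
- by move=> /(_ ok'); apply: Or33.
Qed.

(** For [h] at [b] with [origin (q h)] beyond [u], the stabilizer of that vertex fixes [r], hence
    [u] on the way, hence [k]; so the condition applies to [h] and [k]. If [h] is not [k], distances
    from [r] exclude alternative (1), alternative (2) makes [h] a translate of [bar k] to be
    exchanged in its place, and alternative (3) is [exchange_three]. *)
Lemma exchange_base r : p r = b -> vstab b `<=` vstab r -> r <> u -> exchangeable.
Proof.
move=> pr fix_r ru.
have sub h : origin h = b -> beyond (tT S) r u (origin (q h)) ->
    vstab (origin (q h)) `<=` estab k.
  move=> oh byd g gh; apply: fix_k; apply: (fix_beyond byd) => //.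
  by apply: fix_r; apply: fix_b gh; rewrite -(origin_lift pq).
have sub' h : origin h = b -> beyond (tT S) r u (origin (q h)) ->
    estab h `<=` estab k.
  move=> oh byd; apply: subset_trans (sub h oh byd).
  by rewrite -(estab_lift pq); apply: estab_origin.
have eq_k h c : origin h = b -> beyond (tT S) r u (origin (q h)) ->
    h = eact c k -> h = k.
  move=> oh byd E; have cb : vstab b c by move: oh; rewrite E origin_eact.
  have cu : vact c u = u.
    move: byd; rewrite E (lift_act pq) origin_eact => /beyond_dist_eq; apply.
    by rewrite -{1}(fix_r _ cb) dist_act.
  by rewrite E; apply: fix_k.
have [only_k|] := pselect (forall h, origin h = b ->
    beyond (tT S) r u (origin (q h)) -> h = k).
  exact: (@contraction_exchange _ _ _ _ _ pq k r).
move=> /existsNP [h /not_implyP [oh /not_implyP [byd nhk]]].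
have [[c /(eq_k _ _ oh byd)] //|[[g hE] sh] |//] := exchange_or oh (sub' h oh byd).
pose U := origin (q h).
have UE : U = vact g (terminus (q k)).
  by rewrite /U hE (lift_act pq) (lift_bar pq) origin_eact.
apply: contrapT => nex; apply: (nex); apply: (exchangeable_orbit hE).
apply: (@contraction_exchange _ _ _ _ _ pq h r); rewrite ?oh //.
- by move=> E; apply: ru; rewrite -E in byd; rewrite (beyond_root byd).
- by rewrite sh; apply: sub.
move=> h' oh' byd'; have byd2 := beyond_trans byd byd'.
have [[c /(eq_k _ _ oh' byd2) E]|[[g' E] _]|ex] := exchange_or oh' (sub' h' oh' byd2).
- case: (not_loop (g := g)); rewrite -UE; apply: (beyond_dist_eq byd).
  by apply: beyond_dist; rewrite E in byd'.
- have E' : h' = eact (g' * g^-1) h by rewrite hE eactM eactK.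
  have cb : vstab b (g' * g^-1).
    by move: oh'; rewrite E' origin_eact oh.
  move: (g' * g^-1) E' cb => c E' cb.
  have cu : vact c u = u.
    have := beyond_act c byd; rewrite (fix_r _ cb) => byd3.
    apply: (beyond_same_dist byd3); last by rewrite -{1}(fix_r _ cb) dist_act.
    by rewrite -origin_eact -(lift_act pq) -E'.
  by rewrite E'; have := fix_k cu; rewrite -sh.
- by case: nex.
Qed.

(** If [u] is the only point of its fiber fixed by [vstab b], then [vstab b] fixes [k], and [k] is a
    loop of the quotient since [T] is reduced. Its reversed translate [k'] at [b] lifts to an edge
    with another origin than [u], so [vstab b] does not fix [k']. But for the pair [k'], [k],
    alternative (1) violates the absence of inversions, and the other two make [vstab b] fix
    [k']. *)
Lemma exchange_exists : exchangeable.
Proof.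
have [[r [pr fix_r ru]]|nr] := pselect
    (exists r, [/\ p r = b, vstab b `<=` vstab r & r <> u]).
  exact: (exchange_base pr fix_r ru).
have [r pr fix_r] := fiber_fix pq b.
have ru : r = u by apply: contrapT => ne; apply: nr; exists r.
rewrite ru in fix_r.
have sk := subset_trans fix_r fix_k.
have [|g bE] := (reducedP T).1 rT (bar k).
  by rewrite terminus_bar estab_bar.
pose k' := eact g (bar k).
have ok' : origin k' = b.
  by rewrite terminus_bar in bE; rewrite origin_eact -bE.
have UE : origin (q k') = vact g (terminus (q k)).
  by rewrite (lift_act pq) (lift_bar pq) origin_eact.
have nfix : ~ vstab b `<=` vstab (origin (q k')).
  move=> fix_U; apply: nr; exists (origin (q k')); split=> //.
    by rewrite -(origin_lift pq).
  by rewrite UE.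
have nsk' : ~ vstab b `<=` estab k'.
  move=> sub; apply/nfix/(subset_trans sub).
  by rewrite -(estab_lift pq); apply: estab_origin.
have sk'k : estab k' `<=` estab k.
  by apply: subset_trans sk; rewrite -ok'; apply: estab_origin.
have [/(local_orbit_eq ok' (erefl b)) [c E]|[_ E]|] := cT ok' (erefl b) sk'k.
- by move: E; rewrite -eactM -{1}(eact1 k) => /not_inverted.
- by case: nsk'; rewrite E.
case=> f' [of' /esym/eorbit_eq [c f'E] [_ sf'] _ _]; case: nsk' => x xb.
have f'E' : f' = eact (c * g^-1) k' by rewrite f'E eactM eactK.
have cb : vstab b (c * g^-1) by move: of'; rewrite f'E' origin_eact ok'.
move: (c * g^-1) f'E' cb => d f'E' cb.
have : vstab b (d * x * d^-1) by rewrite /vstab /= !vactM (vstabV cb) xb.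
rewrite -sf' f'E' => /estab_act.
by rewrite !mulgA mulVg mul1g -mulgA mulVg mulg1.
Qed.

End Exchanges.

(** Once an exchange has made [e] a collapsed edge, the contraction onto [T] factors through [S'].
    The vertex with the stabilizer of [e] is its terminus, so the exchange is applied to [bar e]. *)
Lemma contracts_collapse S S' T :
  reduced T -> rigidity_condition T -> contracts S T -> collapse_move S S' ->
  contracts S' T.
Proof.
move=> rT cT [p [q pq]] [e [ce Sce]].
have [p1 [q1 [c1 rq1]]] := collapse_contraction ce Sce.
suff [p' [q' [c' nq']]] : exists p' q', @contraction G S T p' q' /\ ~ range q' e.
  apply: (contracts_factor c1 c'); rewrite rq1 => f qf.
  case=> /eorbitP [g E]; apply: nq'; last apply: (range_bar c');
    by apply: (range_act c' (g := g)); rewrite -E.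
have [[k0 _ qk0]|ne] := pselect (range q e); last by exists p, q.
have qk : q (bar k0) = bar e by rewrite (lift_bar pq) qk0.
case: ce => ne se.
have [||p' [q' [c' nq']]] := @exchange_exists S T p q pq (bar k0) _ _ rT cT.
- by rewrite qk -(estab_lift pq) qk estab_bar se.
- move=> g; rewrite qk terminus_bar -/(terminus e) => E.
  by apply/ne/vorbit_eq; exists g.
exists p', q'; split=> // eq'; apply: nq'; rewrite qk.
by apply: (range_bar c'); rewrite barK.
Qed.

Lemma contracts_deformation S S' T :
  reduced T -> rigidity_condition T -> deformation S S' -> contracts S T ->
  contracts S' T.
Proof.
move=> rT cT; elim=> {S S'} [S S' [iso|exp|col]|//|S1 S2 S3 _ IH1 _ IH2 /IH1/IH2 //].
- by apply: contracts_trans; apply: iso_contracts.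
- apply: contracts_trans; case: exp => e [ce Te].
  by have [p [q [c _]]] := collapse_contraction ce Te; exists p, q.
- by move=> cST; apply: contracts_collapse cST col.
Qed.

Lemma rigid_of_condition T : reduced T -> rigidity_condition T -> rigid T.
Proof.
move=> rT cT; split=> // T' defT rT'.
have [p [q c]] := contracts_deformation rT cT defT (contracts_refl T).
exact: contraction_reduced_iso c rT'.
Qed.

End Rigidity.

(** * Expansions and slides *)

Section Connected.
Variable X : graph.

Definition joined (x y : vertex X) := exists s, walk x s y.

Lemma joined_refl x : joined x x. Proof. by exists [::]. Qed.

Lemma joined_trans x y z : joined x y -> joined y z -> joined x z.
Proof.
by move=> [s w] [s' w']; exists (s ++ s'); apply/walk_cat; exists y.
Qed.

Lemma joined_sym x y : joined x y -> joined y x.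
Proof. by move=> [s w]; exists (bar_seq s); apply: walk_bar_seq. Qed.

Lemma joined_edge (e : edge X) : joined (origin e) (terminus e).
Proof. by exists [:: e]. Qed.

End Connected.

Lemma joined_map (X Y : graph) (p : vertex X -> vertex Y) :
  (forall e : edge X, joined (p (origin e)) (p (terminus e))) ->
  forall x y, joined x y -> joined (p x) (p y).
Proof.
move=> H x y [s]; elim: s x => [|e s IH] x /=; first by move=> ->; apply: joined_refl.
by case=> <- /IH; apply: joined_trans.
Qed.

Section Expansion.
Local Open Scope group_scope.
Variables (G : groupType) (T : gtree G) (W : Type) (wact : G -> W -> W).
Variables (base : W -> vertex T) (att : edge T -> option W).
Hypothesis wact1 : forall w, wact 1 w = w.
Hypothesis wactM : forall g h w, wact (g * h) w = wact g (wact h w).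
Hypothesis base_act : forall g w, base (wact g w) = vact g (base w).
Hypothesis att_act : forall g e, att (eact g e) = omap (wact g) (att e).
Hypothesis att_base : forall e w, att e = Some w -> base w = origin e.

Definition exp_origin (h : edge T + W * bool) : vertex T + W :=
  match h with
  | inl e => if att e is Some w then inr w else inl (origin e)
  | inr (w, true) => inl (base w)
  | inr (w, false) => inr w
  end.

Definition exp_bar (h : edge T + W * bool) : edge T + W * bool :=
  match h with inl e => inl (bar e) | inr (w, c) => inr (w, ~~ c) end.

Fact exp_barK : involutive exp_bar.
Proof. by case=> [e|[w c]] /=; rewrite ?barK ?negbK. Qed.

Fact exp_bar_neq h : exp_bar h <> h.
Proof. by case: h => [e|[w []]] //= [] /bar_neq. Qed.

(* Each [w : W] becomes a new vertex, joined to [base w] by a new edge, and the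
   edges [e] with [att e = Some w] are moved from [base w] to [w]. *)
Definition exp_graph : graph :=
  @Graph (vertex T + W) (edge T + W * bool) exp_origin exp_bar exp_barK exp_bar_neq.

Definition exp_vact g (x : vertex exp_graph) : vertex exp_graph :=
  match x with inl x => inl (vact g x) | inr w => inr (wact g w) end.

Definition exp_eact g (h : edge exp_graph) : edge exp_graph :=
  match h with inl e => inl (eact g e) | inr (w, c) => inr (wact g w, c) end.

Fact exp_tree : is_tree exp_graph.
Proof.
have jw (w : W) : joined (X := exp_graph) (inl (base w)) (inr w).
  exact: (joined_edge (X := exp_graph) (inr (w, true))).
have [[x0] cT _] := tT T.
apply: potentials_tree.
- by constructor; left.
- have jl (x y : vertex T) : joined (X := exp_graph) (inl x) (inl y).
    apply: (joined_map (X := T) (Y := exp_graph) (p := inl)); last exact: cT.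
    have jo e : joined (X := exp_graph) (inl (origin e)) (exp_origin (inl e)).
      rewrite /=; case E: (att e) => [w|]; last exact: joined_refl.
      by rewrite -(att_base E).
    move=> e; apply: (joined_trans (jo e)); apply: joined_trans (joined_sym (jo (bar e))).
    exact: (joined_edge (X := exp_graph) (inl e)).
  have j0 z : joined (X := exp_graph) (inl x0) z.
    by case: z => [y //|w]; apply: joined_trans (jw w).
  by move=> x y; apply: joined_trans (j0 y); apply/joined_sym.
(* Going between the old ends of [e] also crosses the new edges at those ends that were moved; [a]
   is the value of [c] there. *)
move=> c cb; pose a e := if att e is Some w then c (inr (w, true)) else false.
have [|phi phiE] := tree_potentials (tT T)
    (c := fun e => c (inl e) (+) a e (+) a (bar e)).
  by move=> e; rewrite barK -(cb (inl e)) /= addbAC.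
exists (fun z => match z with
  | inl x => phi x | inr w => phi (base w) (+) c (inr (w, true)) end).
have phi_o e : match exp_origin (inl e) with
    | inl x => phi x | inr w => phi (base w) (+) c (inr (w, true)) end
    = phi (origin e) (+) a e.
  by rewrite /= /a; case E: (att e) => [w|]; rewrite ?(att_base E) ?addbF.
case=> [e|[w d]].
  rewrite /terminus /= !phi_o.
  have := phiE e; rewrite /terminus => {phiE}.
  by case: (c _); case: (a e); case: (a _); case: (phi _); case: (phi _).
have := cb (inr (w, true)); rewrite /terminus /=.
by case: d => /=; case: (phi _); case: (c _); case: (c _).
Qed.

Fact exp_vact1 x : exp_vact 1 x = x.
Proof. by case: x => [x|w] /=; rewrite ?vact1 ?wact1. Qed.

Fact exp_vactM g h x : exp_vact (g * h) x = exp_vact g (exp_vact h x).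
Proof. by case: x => [x|w] /=; rewrite ?vactM ?wactM. Qed.

Fact exp_eact1 x : exp_eact 1 x = x.
Proof. by case: x => [x|[w c]] /=; rewrite ?eact1 ?wact1. Qed.

Fact exp_eactM g h x : exp_eact (g * h) x = exp_eact g (exp_eact h x).
Proof. by case: x => [x|[w c]] /=; rewrite ?eactM ?wactM. Qed.

Fact exp_origin_eact g e : exp_origin (exp_eact g e) = exp_vact g (exp_origin e).
Proof.
case: e => [e|[w []]] //=; last by rewrite base_act.
by rewrite att_act; case: (att e) => //=; rewrite origin_eact.
Qed.

Fact exp_bar_eact g e : exp_bar (exp_eact g e) = exp_eact g (exp_bar e).
Proof. by case: e => [e|[w c]] //=; rewrite bar_eact. Qed.

Fact exp_no_inversion g e : exp_eact g e <> exp_bar e.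
Proof. by case: e => [e|[w []]] //= [] /no_inversion. Qed.

Definition expansion : gtree G :=
  @GTree G exp_graph exp_tree exp_vact exp_eact exp_vact1 exp_vactM exp_eact1
    exp_eactM exp_origin_eact exp_bar_eact exp_no_inversion.

Lemma expansion_collapse w0 : (forall w, exists g, w = wact g w0) ->
  collapse_move expansion T.
Proof.
move=> tW; exists (inr (w0, true) : edge expansion); split.
  split; first by move/vorbit_eq => [g].
  by apply/seteqP; split=> g; rewrite /estab /vstab /= => -[->].
exists (fun z : vertex expansion => match z with inl x => x | inr w => base w end).
exists (fun e => inl e : edge expansion).
have inA w c : unoriented_orbit (inr (w0, true) : edge expansion)
    (inr (w, c) : edge expansion).
  have [g ->] := tW w.
  by case: c; [left|right]; apply/eorbitP; exists g.
split.
- by apply/seteqP; split=> // x _; exists (inl x).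
- pose A := unoriented_orbit (inr (w0, true) : edge expansion).
  have near (x : vertex expansion) : linked A x
      (inl match x with inl x => x | inr w => base w end : vertex expansion).
    case: x => [x|w]; first exact: rst_refl.
    apply: rst_sym.
    exact: (@linked_edge _ expansion A (inr (w, true)) (inA w true)).
  move=> x y; split=> [E|].
    by apply: (rst_trans _ _ _ _ _ (near x)); rewrite E; apply/rst_sym/near.
  apply: (@linked_eq _ expansion _ A
    (fun z => match z with inl x => x | inr w => base w end) _ x y).
  by move=> f [/eorbitP [g ->]|/eorbitP [g ->]].
- split; first by move=> ? ? [].
  apply/seteqP; split=> [_ [e _ <-]|[e _|[w c] []]]; last exact: inA.
    by case=> /eorbitP [].
  by exists e.
- split; last by [].
  by move=> g [x|w] //=; rewrite base_act.
split=> // e; rewrite /= /origin /=.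
by case E: (att e) => [w|] //; rewrite (att_base E).
Qed.

End Expansion.

Section Slide.
Local Open Scope group_scope.
Variables (G : groupType) (T : gtree G) (e f : edge T).
Hypothesis oef : origin e = origin f.
Hypothesis sub_ef : estab e `<=` estab f.
Hypothesis nef : forall g, e <> eact g f.

(** The orbit of [f] as a type of new vertices: their stabilizers are then the conjugates of
    [G_f]. *)
Definition copy := {k : edge T | exists g, k = eact g f}.

Definition copy_of g : copy := exist _ (eact g f) (ex_intro _ g erefl).

Fact copy_act_proof g (w : copy) : exists h, eact g (sval w) = eact h f.
Proof. by case: w => k [h E] /=; exists (g * h); rewrite E eactM. Qed.

Definition copy_act g (w : copy) : copy := exist _ _ (copy_act_proof g w).

Lemma copyE (w w' : copy) : sval w = sval w' -> w = w'.
Proof. by case: w w' => [k ?] [k' ?] /= E; apply: eq_exist. Qed.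

Lemma copyP w : exists g, w = copy_of g.
Proof. by case: w => k [g E]; exists g; apply: copyE. Qed.

Lemma copy_act_of g h : copy_act g (copy_of h) = copy_of (g * h).
Proof. by apply: copyE; rewrite /= eactM. Qed.

(** The inclusion of [G_e] in [G_f] makes the vertex attached to [g e] independent of [g], and [nef]
    keeps it from conflicting with the one attached to translates of [f]. *)
Fact attach_exists : exists att : edge T -> option copy,
  [/\ forall g, att (eact g f) = Some (copy_of g),
      forall g, att (eact g e) = Some (copy_of g) &
      forall h, (forall g, h <> eact g f) -> (forall g, h <> eact g e) -> att h = None].
Proof.
have [|a1 [a1e a1n]] := @extend_along G (edge T) (option copy) (fun g h => h = eact g e)
    (fun g => Some (copy_of g)) (fun=> None).
  move=> g g' h -> /eact_stab/sub_ef/eact_stab E.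
  by congr Some; apply: copyE.
have [|a2 [a2f a2n]] := @extend_along G (edge T) (option copy) (fun g h => h = eact g f)
    (fun g => Some (copy_of g)) a1.
  by move=> g g' h -> E; congr Some; apply: copyE.
exists a2; split=> [g|g|h nf ne].
- exact: a2f.
- rewrite a2n; first exact: a1e.
  by move=> h E; apply: (@nef (g^-1 * h)); rewrite eactM -E eactK.
- by rewrite a2n // a1n.
Qed.

Definition attach := sval (cid attach_exists).

Lemma attach_f g : attach (eact g f) = Some (copy_of g).
Proof. by rewrite /attach; case: cid => a []. Qed.

Lemma attach_e g : attach (eact g e) = Some (copy_of g).
Proof. by rewrite /attach; case: cid => a []. Qed.

Lemma attach_none h : (forall g, h <> eact g f) -> (forall g, h <> eact g e) ->
  attach h = None.
Proof. by rewrite /attach; case: cid => a [_ _ an] /=; apply: an. Qed.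

Lemma attachP h : [\/ exists g, h = eact g f, exists g, h = eact g e | attach h = None].
Proof.
have [?|nf] := pselect (exists g, h = eact g f); first exact: Or31.
have [?|ne] := pselect (exists g, h = eact g e); first exact: Or32.
by apply/Or33/attach_none => g E; [apply: nf|apply: ne]; exists g.
Qed.

Fact copy_act1 w : copy_act 1 w = w.
Proof. by apply: copyE; rewrite /= eact1. Qed.

Fact copy_actM g h w : copy_act (g * h) w = copy_act g (copy_act h w).
Proof. by apply: copyE; rewrite /= eactM. Qed.

Fact copy_base_act g w : origin (sval (copy_act g w)) = vact g (origin (sval w)).
Proof. by rewrite /= origin_eact. Qed.

Fact attach_act g h : attach (eact g h) = omap (copy_act g) (attach h).
Proof.
case: (attachP h) => [[h' ->]|[h' ->]|E].
- by rewrite -eactM !attach_f /= copy_act_of.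
- by rewrite -eactM !attach_e /= copy_act_of.
case: (attachP (eact g h)) => [[h' E']|[h' E']|->]; last by rewrite E.
- by move: E; rewrite -(eactK g h) E' -eactM attach_f.
- by move: E; rewrite -(eactK g h) E' -eactM attach_e.
Qed.

Fact attach_base h w : attach h = Some w -> origin (sval w) = origin h.
Proof.
case: (attachP h) => [[g ->]|[g ->]|->//]; rewrite ?attach_f ?attach_e => -[<-] //=.
by rewrite !origin_eact oef.
Qed.

(* The tree with a new vertex [w], [G_w = G_f], joined to the common origin of
   [e] and [f] and from which both [e] and [f] now start. *)
Definition blowup : gtree G :=
  expansion copy_act1 copy_actM copy_base_act attach_act attach_base.

Lemma blowup_collapse : collapse_move blowup T.
Proof.
apply: (@expansion_collapse _ _ _ _ _ _ _ _ _ _ _ (copy_of 1)) => w.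
by have [g ->] := copyP w; exists g; rewrite copy_act_of mulg1.
Qed.

Hypothesis nefb : forall g, e <> eact g (bar f).

(** Gives the edge over which the origin of a translate of [e] slides. *)
Fact moved_exists : exists mv : edge T -> option (edge T),
  (forall g, mv (eact g e) = Some (eact g f)) /\
  (forall h, (forall g, h <> eact g e) -> mv h = None).
Proof.
have [|a [ae an]] := @extend_along G (edge T) (option (edge T)) (fun g h => h = eact g e)
    (fun g => Some (eact g f)) (fun=> None).
  by move=> g g' h -> /eact_stab/sub_ef/eact_stab ->.
by exists a; split=> [g|h ne]; [apply: ae|apply: an].
Qed.

Definition moved := sval (cid moved_exists).

Lemma moved_e g : moved (eact g e) = Some (eact g f).
Proof. by rewrite /moved; case: cid => a []. Qed.

Lemma moved_none h : (forall g, h <> eact g e) -> moved h = None.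
Proof. by rewrite /moved; case: cid => a [_ an] /=; apply: an. Qed.

Lemma movedP h : (exists2 g, h = eact g e & moved h = Some (eact g f)) \/
  (forall g, h <> eact g e) /\ moved h = None.
Proof.
have [[g ->]|ne] := pselect (exists g, h = eact g e).
  by left; exists g => //; apply: moved_e.
have ne' g : h <> eact g e by move=> E; apply: ne; exists g.
by right; split=> //; apply: moved_none.
Qed.

Lemma moved_f g : moved (eact g f) = None.
Proof.
by apply: moved_none => h E; apply: (@nef (h^-1 * g)); rewrite eactM E eactK.
Qed.

Lemma moved_bar_f g : moved (bar (eact g f)) = None.
Proof.
apply: moved_none => h; rewrite bar_eact => E.
by apply: (@nefb (h^-1 * g)); rewrite eactM E eactK.
Qed.

Definition slide_origin h : vertex T :=
  if moved h is Some k then terminus k else origin h.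

Definition slide_graph : graph := Graph slide_origin (@barK T) (@bar_neq T).

Lemma slide_origin_e g : slide_origin (eact g e) = vact g (terminus f).
Proof. by rewrite /slide_origin moved_e terminus_eact. Qed.

Lemma slide_origin_other h : (forall g, h <> eact g e) -> slide_origin h = origin h.
Proof. by rewrite /slide_origin => /moved_none ->. Qed.

Fact slide_tree : is_tree slide_graph.
Proof.
have [iT cT _] := tT T; apply: potentials_tree => //.
  have jo h : joined (X := slide_graph) (@origin T h) (slide_origin h).
    rewrite /slide_origin; case: (movedP h) => [[g hE ->]|[_ ->]]; last exact: (joined_refl (X := slide_graph)).
    have := joined_edge (X := slide_graph) (eact g f).
    rewrite /terminus /= /slide_origin moved_f moved_bar_f.
    by rewrite hE !origin_eact oef.
  move=> x y; apply: (joined_map (X := T) (Y := slide_graph) (p := id)); last exact: cT.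
  move=> h; apply: (joined_trans (jo h)); apply: joined_trans (joined_sym (jo (bar h))).
  exact: (joined_edge (X := slide_graph) h).
(* The old and new origins of [g e] are the two ends of [g f]; [a] is the value of [c] on this
   detour. *)
move=> c cb; pose a h := if moved h is Some k then c k else false.
have [|phi phiE] := tree_potentials (tT T) (c := fun h => c h (+) a h (+) a (bar h)).
  by move=> h; rewrite barK -(cb h) /= addbAC.
exists phi => h.
have phi_o k : phi (slide_origin k) = phi (origin k) (+) a k.
  rewrite /slide_origin /a; case: (movedP k) => [[g kE ->]|[_ ->]]; last by rewrite addbF.
  have := phiE (eact g f); rewrite /a moved_f moved_bar_f !addbF => ->.
  by rewrite kE !origin_eact oef addKb.
rewrite /terminus /= !phi_o; have := phiE h; rewrite /terminus.
by case: (c _); case: (a h); case: (a _); case: (phi _); case: (phi _).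
Qed.

Fact slide_origin_eact g h : slide_origin (eact g h) = vact g (slide_origin h).
Proof.
rewrite /slide_origin; case: (movedP h) => [[g' -> _]|[ne ->]].
  by rewrite -eactM !moved_e !terminus_eact vactM.
rewrite moved_none ?origin_eact // => g' E; apply: (ne (g^-1 * g')).
by rewrite eactM -E eactK.
Qed.

Definition slide : gtree G :=
  @GTree G slide_graph slide_tree (@vact _ T) (@eact _ T) (@vact1 _ T)
    (@vactM _ T) (@eact1 _ T) (@eactM _ T) slide_origin_eact (@bar_eact _ T)
    (@no_inversion _ T).

(** In [blowup], [f] goes from the new vertex, whose stabilizer is also [G_f], to an old one, so it
    may be collapsed. This carries the origin of [e] to the terminus of [f], and the new edge takes
    over the role of [f]. *)
Lemma blowup_slide : collapse_move blowup slide.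
Proof.
have orbitf h : (exists g, h = eact g f) -> (forall g, h <> eact g (bar f)).
  by move=> [g ->] g' /not_inverted.
pose F : edge blowup := inl f.
have tF g : terminus (inl (eact g f) : edge blowup) = inl (vact g (terminus f)).
  rewrite /terminus /= bar_eact attach_none; first by rewrite origin_eact.
    by move=> h /esym/not_inverted.
  by move=> h E; apply: (@nefb (h^-1 * g)); rewrite eactM E eactK.
have oF g : origin (inl (eact g f) : edge blowup) = inr (copy_of g).
  by rewrite /= attach_f.
have F1 : F = inl (eact 1 f) by rewrite eact1.
exists (bar F); split.
  split.
    rewrite /terminus barK -/(terminus F) F1 tF oF.
    by move/vorbit_eq => [g].
  rewrite estab_bar /terminus barK F1 oF; apply/seteqP; split=> g.
    by rewrite /estab /vstab /= -eactM => -[E]; congr inr; apply: copyE; rewrite /= -eactM.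
  by rewrite /estab /vstab /= => -[E]; congr inl; rewrite !eact1 in E *.
rewrite /is_collapse unoriented_orbit_bar.
have [|a1 [a1f a1n]] := @extend_along G (edge T) (edge blowup) (fun g h => h = eact g (bar f))
    (fun g => inr (copy_of g, false)) (fun h => inl h).
  move=> g g' h -> /eact_stab; rewrite estab_bar => /eact_stab E.
  by congr (inr (_, _)); apply: copyE.
have [|q [qf qn]] := @extend_along G (edge T) (edge blowup) (fun g h => h = eact g f)
    (fun g => inr (copy_of g, true)) a1.
  by move=> g g' h -> E; congr (inr (_, _)); apply: copyE.
have {}qf g : q (eact g f) = inr (copy_of g, true) by exact: qf.
have qb g : q (eact g (bar f)) = inr (copy_of g, false).
  by rewrite qn; [exact: a1f|move=> h /esym/not_inverted].
have {a1f a1n}qn h : ~ unoriented_orbit f h -> q h = inl h.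
  move=> nh; rewrite qn ?a1n // => g E; apply: nh; [right|left];
    by apply/eorbitP; exists g.
pose p (z : vertex blowup) : vertex slide :=
  match z with inl x => x | inr w => terminus (sval w) end.
have hcase h : [\/ exists g, h = eact g f, exists g, h = eact g (bar f)
                 | ~ unoriented_orbit f h].
  have [[/eorbitP|/eorbitP]|] := pselect (unoriented_orbit f h).
  - exact: Or31.
  - exact: Or32.
  - exact: Or33.
have unF h : unoriented_orbit F (inl h) <-> unoriented_orbit f h.
  split=> [[/eorbitP [g [->]]|/eorbitP [g [->]]]|[/eorbitP [g ->]|/eorbitP [g ->]]].
  - by left; apply/eorbitP; exists g.
  - by right; apply/eorbitP; exists g.
  - by left; apply/eorbitP; exists g.
  - by right; apply/eorbitP; exists g.
have pE g : p (inr (copy_of g)) = vact g (terminus f) by rewrite /= terminus_eact.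
exists p, q; split.
- by apply/seteqP; split=> // x _; exists (inl x).
- have near z : linked (unoriented_orbit F) z (inl (p z) : vertex blowup).
    case: z => [x|w]; first exact: rst_refl.
    have [g ->] := copyP w; rewrite pE -tF -oF.
    by apply: linked_edge; left; apply/eorbitP; exists g.
  move=> x y; split=> [E|].
    by apply: (rst_trans _ _ _ _ _ (near x)); rewrite E; apply/rst_sym/near.
  apply: (@linked_eq _ blowup _ _ p _ x y).
  move=> h [/eorbitP [g ->]|/eorbitP [g ->]].
    by rewrite oF tF /= terminus_eact.
  rewrite -bar_eact terminus_bar -/(terminus _) [eact g F]/= oF tF.
  by rewrite /= terminus_eact.
- split.
    move=> h h'; case: (hcase h) => [[g ->]|[g ->]|nh];
      case: (hcase h') => [[g' ->]|[g' ->]|nh']; rewrite ?qf ?qb ?qn //.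
    + by case.
    + by case=> E; rewrite -!bar_eact E.
    + by case.
  apply/seteqP; split=> [_ [h _ <-]|[h nh|[w c] _]].
  - case: (hcase h) => [[g ->]|[g ->]|nh]; rewrite ?qf ?qb ?qn //.
    + by case=> /eorbitP [].
    + by case=> /eorbitP [].
    + by move/unF.
  - by exists h => //; rewrite qn // => /unF.
  - have [g ->] := copyP w.
    by case: c; [exists (eact g f)|exists (eact g (bar f))].
- split=> [g [x|w]|g h] //=; first by rewrite terminus_eact.
  case: (hcase h) => [[g' ->]|[g' ->]|nh].
  + by rewrite -eactM !qf /= copy_act_of.
  + by rewrite -eactM !qb /= copy_act_of.
  + rewrite !qn // => /(unoriented_eact g^-1).
    by rewrite eactK.
split=> h; case: (hcase h) => [[g ->]|[g ->]|nh].
- by rewrite qf /= /slide_origin moved_f.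
- rewrite qb /= -bar_eact /slide_origin moved_bar_f //.
- rewrite qn //= /slide_origin; case: (movedP h) => [[g -> ->]|[ne ->]].
    by rewrite attach_e.
  by rewrite attach_none // => g E; apply: nh; left; apply/eorbitP; exists g.
- by rewrite qf /= bar_eact qb.
- by rewrite qb /= bar_eact barK qf.
- by rewrite !qn // => /unoriented_bar; rewrite barK.
Qed.

Lemma deformation_slide : deformation T slide.
Proof.
apply: (rt_trans _ _ _ blowup); apply: rt_step.
  by apply: Or32; apply: blowup_collapse.
by apply: Or33; apply: blowup_slide.
Qed.

End Slide.

(** * Invariants and non-rigidity *)

Section Invariants.
Local Open Scope group_scope.
Variable G : groupType.
Implicit Types S T : gtree G.

(** For a 2-coloring [phi] both sides are the parity of the translation length of [g]: along a walk
    from [x] to [y], each edge and its translate change color together. *)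
Lemma parity_shift T (phi : vertex T -> bool) g x y :
  (forall e : edge T, true = phi (origin e) (+) phi (terminus e)) ->
  phi x (+) phi (vact g x) = phi y (+) phi (vact g y).
Proof.
move=> H; have [_ /(_ x y) [s w] _] := tT T.
elim: s x w => [|e s IH] x /=; first by move=> ->.
case=> <- /IH <-; have := H e; have := H (eact g e).
rewrite origin_eact terminus_eact.
by case: (phi _); case: (phi _); case: (phi _); case: (phi _).
Qed.

Lemma iso_transport S T : gtree_iso S T ->
  exists phi : vertex S -> vertex T,
    [/\ forall x, vstab (phi x) = vstab x,
        forall x y, dist (tT T) (phi x) (phi y) = dist (tT S) x y &
        forall z, exists x, phi x = z].
Proof.
move=> [phi [psi [[bphi [psi' psiK _]] phiA psiA opsi bpsi]]].
have phi_inj := bij_inj bphi.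
exists phi; split.
- move=> x; apply/seteqP; split=> g; rewrite /vstab /= -phiA; last by move=> ->.
  by move/phi_inj.
- move=> x y; rewrite /dist; have -> : geod (tT T) (phi x) (phi y) = map psi (geod (tT S) x y).
    apply: geod_uniq.
      move: (geod _ x y) (geod_walk (tT S) x y) => s.
      elim: s (x) => [|e s IH] z /=.
        by move=> ->.
      by case=> <- /IH; rewrite /terminus -opsi bpsi.
    rewrite sorted_map; apply: sub_sorted (geod_sorted (tT S) x y) => e f /asboolP ne.
    by apply/asboolP; rewrite bpsi => /(can_inj psiK).
  by rewrite size_map.
by case: bphi => phi' _ phi'K z; exists (phi' z).
Qed.

(** The fixed subtrees of [A] and [B] are at distance at least [n]. *)
Definition separated T (A B : set G) n :=
  forall y z : vertex T, A `<=` vstab y -> B `<=` vstab z -> n <= dist (tT T) y z.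

Lemma separated_iso S T A B n : gtree_iso S T -> separated S A B n <-> separated T A B n.
Proof.
move=> /iso_transport [phi [phiS phiD surj]]; split=> sep y z.
  have [x <-] := surj y; have [x' <-] := surj z.
  by rewrite !phiS phiD; apply: sep.
by rewrite -(phiS y) -(phiS z) -phiD; apply: sep.
Qed.

(** The walk is the bridge between the fixed subtrees: it leaves the first at once and enters the
    second only at its end, so it stays reduced when extended by geodesics inside them. *)
Lemma reduced_separated T (A B : set G) x s y :
  walk x s y -> sorted (@turns T) s -> A `<=` vstab x -> B `<=` vstab y ->
  (forall e s', s = e :: s' -> ~ A `<=` estab e) ->
  (forall e s', s = rcons s' e -> ~ B `<=` estab e) ->
  separated T A B (size s).
Proof.
case: s => [//|e0 s0]; set s := e0 :: s0 => w st Ax By hA hB x' y' Ax' By'.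
have fixed (C : set G) a b e s1 s2 : C `<=` vstab a -> C `<=` vstab b ->
    geod (tT T) a b = s1 ++ e :: s2 -> C `<=` estab e.
  move=> Ca Cb E g /[dup] /Ca ga /Cb gb.
  by have := fix_geod ga gb; rewrite E all_cat /= => /and3P [_ /asboolP].
have -> : dist (tT T) x' y' = size (geod (tT T) x' x ++ s ++ geod (tT T) y y').
  congr size; apply: geod_uniq.
    apply/walk_cat; exists x; split; first exact: geod_walk.
    by apply/walk_cat; exists y; split=> //; apply: geod_walk.
  apply: sorted_join; first exact: geod_sorted.
    apply: sorted_join => //; first exact: geod_sorted.
    move=> s1 e f s2 E1 E2 fE; apply: (hB _ _ E1).
    by rewrite -estab_bar -fE; apply: (fixed _ _ _ _ [::] s2 By By' E2).
  move=> s1 e f s2 E1 [E2 _] fE; apply: (hA e0 s0) => //.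
  rewrite E2 fE estab_bar; apply: (fixed _ _ _ _ s1 [::] Ax' Ax).
  by rewrite E1 cats1.
by rewrite !size_cat addnCA leq_addr.
Qed.

Lemma dist1 T (e : edge T) : dist (tT T) (origin e) (terminus e) = 1%N.
Proof. by rewrite /dist (@geod_uniq _ _ _ _ [:: e]). Qed.

End Invariants.

Section NotRigid.
Local Open Scope group_scope.
Variables (G : groupType) (T : gtree G) (e f : edge T).
Hypothesis rT : reduced T.
Hypothesis oef : origin e = origin f.
Hypothesis sub_ef : estab e `<=` estab f.
Hypothesis nef : forall g, e <> eact g f.
Hypothesis nefb : forall g, e <> eact g (bar f).

Let T' := slide oef sub_ef nef nefb.

Let slide_other h : (forall g, h <> eact g e) -> @origin T' h = @origin T h.
Proof. exact: slide_origin_other. Qed.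

Let slide_e : @origin T' e = @terminus T f.
Proof. by have := slide_origin_e sub_ef 1; rewrite eact1 vact1. Qed.

Let ne_bar_e g : bar e <> eact g e.
Proof. by move/esym/no_inversion. Qed.

Let slide_te : @terminus T' e = @terminus T e.
Proof. exact: slide_other. Qed.

Let slide_f : @origin T' f = @origin T f.
Proof. by apply: slide_other => g E; apply: (@nef g^-1); rewrite E eactK. Qed.

Let slide_tf : @terminus T' f = @terminus T f.
Proof.
by apply: slide_other => g E; apply: (@nefb g^-1); rewrite E eactK.
Qed.

(** Only translates of [e] and [bar e] change an endpoint. The slid edge joins [terminus f] to
    [terminus e], and is not collapsible if these lie in one orbit or if neither has its stabilizer
    in [G_e]. *)
Lemma slide_reduced :
  (exists g, terminus e = vact g (terminus f)) \/
  (~ vstab (terminus e) `<=` estab e /\ ~ vstab (terminus f) `<=` estab e) ->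
  reduced T'.
Proof.
move=> hyp; apply/reducedP => h sub.
have conj (x : vertex T) g : vstab (vact g x) `<=` estab (eact g e) -> vstab x `<=` estab e.
  move=> s a ax; have /s/estab_act : vstab (vact g x) (g * a * g^-1).
    by apply/vstab_act; rewrite !mulgA mulVg mul1g -mulgA mulVg mulg1.
  by rewrite !mulgA mulVg mul1g -mulgA mulVg mulg1.
have [[g hE]|ne] := pselect (exists g, h = eact g e).
  move: sub; rewrite hE (terminus_eact (T := T')) (origin_eact (g0 := T')) slide_te slide_e.
  case: hyp => [[a aE] _|[ne _] /conj //].
  by exists (g * a * g^-1); rewrite aE !vactM vactK.
have [[g hE]|neb] := pselect (exists g, h = eact g (bar e)).
  move: sub; rewrite hE (terminus_eact (T := T')) (origin_eact (g0 := T')).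
  rewrite (terminus_bar (X := T')) -/(@terminus T' e) slide_te slide_e.
  case: hyp => [[a aE] _|[_ ne'] sub]; last first.
    by case: ne'; apply: (conj _ g); rewrite -estab_bar bar_eact.
  exists (g * a^-1 * g^-1); rewrite aE !vactM vactK.
  by rewrite -(vactM a^-1) mulVg vact1.
have oh : @origin T' h = @origin T h.
  by apply: slide_other => g E; apply: ne; exists g.
have th : @terminus T' h = @terminus T h.
  apply: slide_other => g E; apply: neb; exists g.
  by rewrite -[h](barK (g := T)) E bar_eact.
by rewrite oh th; apply: (reducedP T).1; rewrite -?th.
Qed.

Lemma slide_not_rigid : reduced T' -> ~ gtree_iso T T' -> ~ rigid T.
Proof. by move=> rT' niso [_ /(_ T' (deformation_slide _ _ _ _) rT')]. Qed.

(** [g] moves [origin e] along one edge in [T], but along the two edges [f], [e] in the slid tree,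
    so its translation length changes parity. *)
Lemma loop_not_rigid :
  (exists g, terminus e = vact g (origin e)) -> reduced T' -> ~ rigid T.
Proof.
move=> [g te] rT'; apply: slide_not_rigid => // -[phi [psi [_ phiA _ opsi bpsi]]].
have [|c cE] := tree_potentials (tT T') (c := fun=> true); first by [].
have := cE (psi e); rewrite /terminus opsi bpsi opsi -/(terminus e) te phiA.
rewrite -/(vact g (phi _ : vertex T')).
rewrite (parity_shift (T := T') g (phi (origin e)) (origin f) cE).
have := cE f; have := cE e; rewrite slide_f slide_tf slide_e slide_te te oef.
by case: (c _); case: (c _); case: (c _).
Qed.

Hypothesis not_loop : forall g, terminus e <> vact g (origin e).

Let not_fix_te : ~ vstab (terminus e) `<=` estab e.
Proof. by move/(reducedP T).1 => -[//|g /not_loop]. Qed.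

Let not_fix_oe : ~ vstab (origin e) `<=` estab e.
Proof.
move=> sub; have [|g] := (reducedP T).1 rT (bar e).
  by rewrite terminus_bar estab_bar.
by rewrite terminus_bar => E; apply: (@not_loop g^-1); rewrite E vactK.
Qed.

(** The slide brings fixed subtrees closer: in [T] the bridge for the stabilizers of [terminus f]
    and [terminus e] is [bar f], [e], while in the slid tree these vertices are adjacent. *)
Lemma ascending_not_rigid :
  vstab (origin f) `<=` estab f -> ~ vstab (terminus f) `<=` vstab (origin f) ->
  ~ rigid T.
Proof.
move=> sf nuv; apply: slide_not_rigid.
  apply: slide_reduced; right; split=> // sub; apply: nuv.
  apply: subset_trans (subset_trans sub sub_ef) _; exact: estab_origin.
move=> iso; pose A := vstab (terminus f); pose B := vstab (terminus e).
suff sep : separated T A B 2.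
  have := (separated_iso A B 2 iso).1 sep (@origin T' e) (@terminus T' e).
  by rewrite dist1 slide_e slide_te => /(_ (@subset_refl _ _) (@subset_refl _ _)).
apply: (@reduced_separated _ _ A B (terminus f) [:: bar f; e] (terminus e)) => //.
- by rewrite /= terminus_bar.
- by rewrite /= andbT; apply/asboolP; rewrite barK -(eact1 f).
- move=> a s' [<- _]; rewrite estab_bar => sub; apply: nuv.
  by apply: subset_trans sub _; apply: estab_origin.
- by move=> a s' /(@rcons_inj _ [:: bar f] _ e) [_ <-].
Qed.

(** The slide moves fixed subtrees apart: for the stabilizers of the two ends of [e] in [T], the
    bridge in the slid tree is [f], [e]. *)
Lemma strict_not_rigid :
  ~ vstab (origin f) `<=` estab f -> ~ vstab (terminus f) `<=` estab e ->
  ~ rigid T.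
Proof.
move=> nf nu; apply: slide_not_rigid; first by apply: slide_reduced; right.
move=> iso; pose A := vstab (origin e); pose B := vstab (terminus e).
suff sep : separated T' A B 2.
  have := (separated_iso A B 2 iso).2 sep (origin e) (terminus e).
  by rewrite dist1 => /(_ (@subset_refl _ _) (@subset_refl _ _)).
apply: (@reduced_separated _ T' A B (origin e) [:: f; e] (terminus e)) => //.
- by do 2?split; rewrite ?slide_f ?slide_e ?slide_tf ?slide_te.
- by rewrite /= andbT; apply/asboolP; rewrite -(eact1 (bar f)).
- by move=> a s' [<- _]; rewrite /A oef.
- by move=> a s' /(@rcons_inj _ [:: f] _ e) [_ <-].
Qed.

(** The edge [h] marks the place that [e] has left: from [terminus e] to [terminus h] there are two
    edges in [T], while the bridge in the slid tree is [bar e], [bar f], [h]. *)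
Lemma third_edge_not_rigid h :
  vstab (origin f) `<=` estab f -> origin h = origin f ->
  (forall g, h <> eact g e) -> (forall g, h <> eact g f) ->
  (forall g, terminus h <> vact g (origin h)) ->
  ~ rigid T.
Proof.
move=> sf oh nhe nhf nloop; apply: slide_not_rigid.
  apply: slide_reduced; right; split=> // sub; apply: not_fix_oe.
  rewrite oef; apply: subset_trans sf (subset_trans _ sub).
  exact: estab_terminus.
move=> iso; pose A := vstab (terminus e); pose B := vstab (terminus h).
have sh : ~ vstab (terminus h) `<=` estab h.
  by move/(reducedP T).1 => -[//|g /nloop].
have oh' : @origin T' h = @origin T h by apply: slide_other.
have th' : @terminus T' h = @terminus T h.
  apply: slide_other => g E; apply: (nloop g); rewrite /terminus E origin_eact.
  by rewrite oef oh.
have hf : h <> f by rewrite -(eact1 f).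
suff sep : separated T' A B 3.
  have := (separated_iso A B 3 iso).2 sep (terminus e) (terminus h).
  rewrite /dist (@geod_uniq _ _ _ _ [:: bar e; h]) /=.
  - by move=> /(_ (@subset_refl _ _) (@subset_refl _ _)).
  - by rewrite terminus_bar oef oh.
  - by rewrite andbT; apply/asboolP; rewrite barK -(eact1 e).
apply: (@reduced_separated _ T' A B (terminus e) [:: bar e; bar f; h] (terminus h)) => //.
- do 3?split; rewrite ?(terminus_bar (X := T')) ?oh' ?th' ?slide_e ?slide_f //.
- rewrite /= andbT; apply/andP; split; apply/asboolP; rewrite barK.
    by move=> E; apply: (@nefb 1); rewrite eact1.
  exact: hf.
- by move=> a s' [<- _]; rewrite estab_bar.
- by move=> a s' /(@rcons_inj _ [:: bar e; bar f] _ h) [_ <-].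
Qed.

End NotRigid.

(** * From rigidity to the condition on edges *)

Section Main.
Local Open Scope group_scope.
Variable G : groupType.
Implicit Types T : gtree G.

(** Composed with an isomorphism, [i] becomes an injective equivariant self-map of the vertices of
    [T] that misses an orbit. The iterates of that orbit are pairwise distinct, against
    finiteness. *)
Lemma no_extra_orbit T T' (i : vertex T -> vertex T') z :
  finite_set (range (@vorbit _ T)) -> injective i ->
  (forall g x, i (vact g x) = vact g (i x)) ->
  (forall x g, i x <> vact g z) -> ~ gtree_iso T T'.
Proof.
move=> fin i_inj iA iz [phi [_ [[[phi' phiK phi'K] _] phiA _ _ _]]].
have phi'A g x : phi' (vact g x) = vact g (phi' x).
  by rewrite -{1}(phi'K x) -phiA phiK.
pose j x := phi' (i x); pose z0 := phi' z.
have j_inj : injective j by move=> x y /(can_inj phi'K)/i_inj.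
have iterA n g x : iter n j (vact g x) = vact g (iter n j x).
  by elim: n => //= n ->; rewrite /j iA phi'A.
have iter_inj n : injective (iter n j).
  by elim: n => [|n IH] x y //= /j_inj/IH.
have no_return n g : iter n.+1 j z0 <> vact g z0.
  by rewrite /= /j /z0 -phi'A => /(can_inj phi'K)/iz.
pose F n := vorbit (iter n j z0).
have F_inj m n : m < n -> F m <> F n.
  move=> lt_mn /vorbit_eq [g]; rewrite -(subnKC lt_mn) addSnnS iterD -iterA.
  by move/iter_inj; apply: no_return.
have : finite_set (F @^-1` range (@vorbit _ T)).
  apply: finite_preimage => // m n _ _ E.
  by case: (ltngtP m n) => // /F_inj; [case|case; rewrite E].
move=> finF; apply: infinite_nat; apply: sub_finite_set finF => n _.
by exists (iter n j z0).
Qed.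

Section VirtuallyAscending.
Variables (T : gtree G) (e f : edge T) (t : G).
Hypothesis rT : reduced T.
Hypothesis fin : finite_set (range (@vorbit _ T)).
Hypothesis oef : origin e = origin f.
Hypothesis sub_ef : estab e `<=` estab f.
Hypothesis eE : e = eact t (bar f).
Hypothesis nsub : ~ estab f `<=` estab e.
Hypothesis nv : ~ vstab (origin f) `<=` estab f.

Let nef g : e <> eact g f.
Proof. by rewrite eE => /esym/not_inverted. Qed.

Let S := blowup oef sub_ef nef.
Let new : edge S := inr (copy_of f 1, false).
Let old : edge S := inl f.

Let attach_old : attach sub_ef nef f = Some (copy_of f 1).
Proof. by have := attach_f sub_ef nef 1; rewrite eact1. Qed.

Let attach_bar g : attach sub_ef nef (eact g (bar f)) = Some (copy_of f (g * t^-1)).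
Proof.
have -> : eact g (bar f) = eact (g * t^-1) e by rewrite eE eactM eactK.
exact: attach_e.
Qed.

Let o_old : origin new = origin old.
Proof. by rewrite /= attach_old. Qed.

Let sub_new : estab new `<=` estab old.
Proof.
move=> g; rewrite /estab /= copy_act_of mulg1 => -[E]; congr inl.
by rewrite E eact1.
Qed.

Let n_new g : new <> eact g old. Proof. by []. Qed.
Let n_newb g : new <> eact g (bar old). Proof. by []. Qed.

(* [f] is a loop at the new vertices, and the new edge has been slid over it in
   the direction that strictly enlarges the stabilizer of its new endpoint; its
   other end is at [origin f], so that [T'] is reduced. *)
Let T' := slide o_old sub_new n_new n_newb.

Let origin_inl h : @origin T' (inl h) = @origin S (inl h).
Proof. exact: (@slide_origin_other G S new old sub_new (inl h)). Qed.

Let origin_true g : @origin T' (inr (copy_of f g, true)) = inl (vact g (origin f)).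
Proof.
have := @slide_origin_other G S new old sub_new (inr (copy_of f g, true)).
by rewrite /= origin_eact; apply.
Qed.

Let origin_false g : @origin T' (inr (copy_of f g, false)) = inr (copy_of f (g * t^-1)).
Proof.
have := slide_origin_e sub_new g; rewrite /= copy_act_of mulg1 => E.
rewrite -[LHS]/(slide_origin sub_new (inr (copy_of f g, false))).
rewrite E /terminus /= -(eact1 (bar f)) attach_bar.
by rewrite /= copy_act_of mul1g.
Qed.

Let reduced_T' : reduced T'.
Proof.
apply/reducedP => -[h|[w c]].
  rewrite /terminus [bar _]/= !origin_inl.
  have [[g ->] _|nh] := pselect (exists g, h = eact g f).
    rewrite /= bar_eact attach_f attach_bar; exists (g * t^-1 * g^-1).
    by rewrite /= copy_act_of -mulgA mulVg mulg1.
  have [[g ->] _|nhb] := pselect (exists g, h = eact g (bar f)).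
    rewrite /= bar_eact barK attach_f attach_bar; exists (g * t * g^-1).
    by rewrite /= copy_act_of -!mulgA mulKg mulgV mulg1.
  have none k : (forall g, k <> eact g f) -> (forall g, k <> eact g (bar f)) ->
      attach sub_ef nef k = None.
    by move=> nk nkb; apply: attach_none => g; rewrite ?eE -?eactM.
  rewrite /= !none.
  - move=> sub; have [g gx|g E] := (reducedP T).1 rT h.
      have /sub : vstab (inl (origin (bar h)) : vertex T') g.
        by rewrite /vstab /=; congr inl.
      by rewrite /estab /= => -[].
    by exists g; rewrite /= -E.
  - by move=> g E; apply: nh; exists g.
  - by move=> g E; apply: nhb; exists g.
  - by move=> g E; apply: nhb; exists g; rewrite -bar_eact -E barK.
  - by move=> g E; apply: nh; exists g; rewrite -[f](barK (g := T)) -bar_eact -E barK.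
have [g ->] := copyP w.
(* Since [t] takes [bar f] to [e], conjugation turns an inclusion at the slid end into [G_f] inside
   [G_e]; at the other end it would put the stabilizer of [origin f] inside [G_f]. *)
case: c => sub; exfalso.
  apply: nsub => x xf.
  have : estab (inr (copy_of f g, true) : edge T') (g * t^-1 * x * t * g^-1).
    apply: sub; rewrite /terminus [bar _]/= origin_false /vstab /=.
    rewrite copy_act_of; congr inr; apply: copyE => /=.
    by rewrite -!mulgA mulKg mulgV mulg1 mulgA [LHS]eactM xf.
  rewrite /estab /= copy_act_of => -[]; rewrite -!mulgA mulVg mulg1.
  rewrite !eactM => /eact_inj E; rewrite eE.
  apply/estab_act; rewrite estab_bar /estab /=.
  by rewrite !eactM.
apply: nv => x xv.
have : estab (inr (copy_of f g, false) : edge T') (g * x * g^-1).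
  apply: sub; rewrite /terminus [bar _]/= origin_true /vstab /=.
  by rewrite !vactM vactK xv.
rewrite /estab /= copy_act_of => -[]; rewrite -mulgA mulVg mulg1.
by rewrite eactM => /eact_inj.
Qed.

Lemma virtually_ascending_not_rigid : ~ rigid T.
Proof.
move=> [_ /(_ T')] H.
have : gtree_iso T T'.
  apply: H reduced_T'.
  apply: (rt_trans _ _ _ S); last exact: deformation_slide.
  by apply: rt_step; apply: Or32; apply: blowup_collapse.
apply: (@no_extra_orbit T T' inl (inr (copy_of f 1))) => //.
by move=> x y [].
Qed.

End VirtuallyAscending.

Lemma card_three (U : Type) (A B C : U) : A <> B -> A <> C -> B <> C ->
  ([set A; B; C] #= `I_3)%card.
Proof.
move=> AB AC BC; pose F n := if n is n'.+1 then if n' is 0 then B else C else A.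
have -> : [set A; B; C] = [set F n | n in `I_3].
  apply/seteqP; split=> [_ [[->|->]|->]|_ [[|[|[|n]]] // _ <-]].
  - by exists 0.
  - by exists 1%N.
  - by exists 2.
  - by left; left.
  - by left; right.
  - by right.
apply: inj_card_eq => m n; rewrite !inE /=.
by case: m => [|[|[|m]]] /=; case: n => [|[|[|n]]] /= lem len E; (done || congruence).
Qed.

(** Otherwise every edge at [origin f] is a translate of [f] or [bar f] and leads back to the orbit
    of [origin f]. By connectedness there is a single orbit of vertices and of geometric edges, and
    [sf] makes the HNN-extension ascending. *)
Lemma other_edge T (e f : edge T) t :
  ~ ascending_HNN T -> origin e = origin f -> e = eact t (bar f) ->
  vstab (origin f) `<=` estab f ->
  exists h, [/\ origin h = origin f, forall g, h <> eact g f &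
                forall g, h <> eact g (bar f)].
Proof.
move=> nHNN oef eE sf; apply: contrapT => none; apply: nHNN.
have tf : vact t (terminus f) = origin f by rewrite -oef eE origin_eact.
have at_v h : origin h = origin f -> unoriented_orbit f h.
  move=> oh; apply: contrapT => nh; apply: none; exists h; split=> // g E; apply: nh.
    by left; apply/eorbitP; exists g.
  by right; apply/eorbitP; exists g.
have at_orbit g h : origin h = vact g (origin f) -> unoriented_orbit f h.
  move=> oh; rewrite -(eactVK g h); apply/unoriented_eact/at_v.
  by rewrite origin_eact oh vactK.
have all_v x : exists g, x = vact g (origin f).
  have [_ /(_ (origin f) x) [s w] _] := tT T.
  have : exists g, origin f = vact g (origin f) by exists 1; rewrite vact1.
  move: w; move: {1 2}(origin f) => y; elim: s y => [|h s IH] y /=; first by move=> ->.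
  move=> [oy w] [g yE]; apply: IH w _; rewrite -oy in yE; rename yE into oh.
  have [/eorbitP [g' ->]|/eorbitP [g' ->]] := at_orbit g h oh.
    by rewrite terminus_eact; exists (g' * t^-1); rewrite vactM -tf vactK.
  by rewrite terminus_eact terminus_bar; exists g'.
exists (origin f), f, t; split=> //.
- by apply/seteqP; split=> // x _; have [g ->] := all_v x; exists g.
- apply/seteqP; split=> // h _; have [g oh] := all_v (origin h).
  exact: at_orbit oh.
- by left; apply/seteqP; split=> //; apply: estab_origin.
Qed.

Lemma condition_of_rigid T :
  reduced T -> finite_set (range (@vorbit _ T)) -> ~ ascending_HNN T ->
  rigid T -> rigidity_condition T.
Proof.
move=> rT fin nHNN rigT v e f oe of_ sub.
have oef : origin e = origin f by rewrite oe.
have [[g fE]|nfe] := pselect (exists g, f = eact g e).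
  by apply: Or31; apply/local_orbit_eq => //; exists g.
have nef g : e <> eact g f by move=> E; apply: nfe; exists g^-1; rewrite E eactK.
have conjV (g x : G) : g * (g^-1 * x * g) * g^-1 = x.
  by rewrite !mulgA mulgV mul1g -mulgA mulgV mulg1.
have conjK (g x : G) : g^-1 * (g * x * g^-1) * g = x.
  by rewrite !mulgA mulVg mul1g -mulgA mulVg mulg1.
have [[t eE]|nefb'] := pselect (exists t, e = eact t (bar f)).
  have [sfe|nsfe] := pselect (estab f `<=` estab e).
    apply: Or32; split; last by apply/seteqP.
    by apply/eorbit_eq; exists t^-1; rewrite eE eactK.
  exfalso.
  have [sf|nsf] := pselect (vstab (origin f) `<=` estab f); last first.
    exact: (virtually_ascending_not_rigid rT fin oef sub eE nsfe nsf rigT).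
  (* As [G_f = G_v], any other edge [h] at [v] can be slid over [f] in place of [e]. *)
  have [h [oh nhf nhfb]] := other_edge nHNN oef eE sf.
  have sub_hf : estab h `<=` estab f.
    by apply: subset_trans sf; rewrite -oh; apply: estab_origin.
  have tf : terminus f = vact t^-1 (origin f) by rewrite -oef eE origin_eact vactK.
  have [[g th]|nloop] := pselect (exists g, terminus h = vact g (origin h)).
    apply: (loop_not_rigid (oef := oh) (sub_ef := sub_hf) (nef := nhf) (nefb := nhfb)) rigT.
      by exists g.
    apply: slide_reduced => //; left; exists (g * t).
    by rewrite tf vactM vactVK th oh.
  apply: (ascending_not_rigid rT oh sub_hf nhf nhfb _ sf) rigT.
    by move=> g E; apply: nloop; exists g.
  move=> uv; apply: nsfe => x /estab_origin xv.
  rewrite eE; apply/estab_act; rewrite estab_bar; apply/sf/uv; rewrite tf.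
  by apply/vstab_act; rewrite invgK conjV.
have nefb g : e <> eact g (bar f) by move=> E; apply: nefb'; exists g.
have [[g te]|nloop'] := pselect (exists g, terminus e = vact g (origin e)).
  exfalso.
  have [red|nred] := pselect (
    (exists g, terminus e = vact g (terminus f)) \/
    (~ vstab (terminus e) `<=` estab e /\ ~ vstab (terminus f) `<=` estab e)).
    apply: (loop_not_rigid (oef := oef) (sub_ef := sub) (nef := nef) (nefb := nefb)) rigT.
      by exists g.
    exact: slide_reduced.
  move: nred => /not_orP [nteft /not_andP nsub].
  have tf_loop s : terminus f <> vact s (origin f).
    move=> tf; apply: nteft; exists (g * s^-1).
    by rewrite tf vactM vactK te oef.
  case: nsub => /contrapT fix_e; last first.
    have [|s /tf_loop //] := (reducedP T).1 rT f.
    exact: subset_trans fix_e sub.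
  (* The slid tree is not reduced because the stabilizer of [terminus e] is [G_e]. Hence [e1] starts
     at [v] and has stabilizer [G_v], and [f] is slid over it. *)
  pose e1 := eact g^-1 (bar e).
  have oe1 : origin f = origin e1.
    by rewrite origin_eact -/(terminus e) te vactK oef.
  have te1 : terminus e1 = vact g^-1 (origin f).
    by rewrite terminus_eact terminus_bar oef.
  have sv : vstab (origin f) `<=` estab e1.
    move=> x xv; apply/estab_act; rewrite estab_bar; apply: fix_e.
    rewrite te; apply/vstab_act; rewrite oef invgK.
    by rewrite conjK.
  apply: (ascending_not_rigid (e := f) (f := e1) rT) rigT => //.
  - by apply: subset_trans sv; apply: estab_origin.
  - move=> s; rewrite /e1 -eactM => E; apply: (@nefb (s * g^-1)^-1).
    by rewrite E bar_eact barK eactK.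
  - move=> s; rewrite /e1 bar_eact barK -eactM => E; apply: nfe.
    by exists (s * g^-1).
  - by rewrite -oe1.
  rewrite -oe1 te1 => uv.
  have [|s] := (reducedP T).1 rT (bar f).
    rewrite terminus_bar estab_bar => x xv; apply/sub/fix_e.
    rewrite te oef; apply/vstab_act/uv/vstab_act.
    by rewrite invgK conjV.
  rewrite terminus_bar -/(terminus f) => E.
  by apply: (tf_loop s^-1); rewrite E vactK.
have nloop g : terminus e <> vact g (origin e) by move=> E; apply: nloop'; exists g.
have [sf|nsf] := pselect (vstab (origin f) `<=` estab f); last first.
  exfalso; have [ue|nue] := pselect (vstab (terminus f) `<=` estab e); last first.
    exact: (strict_not_rigid rT oef sub nef nefb nloop nsf nue rigT).
  have [|s tf] := (reducedP T).1 rT f; first exact: subset_trans ue sub.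
  (* With the stabilizer of [terminus f] inside [G_e], sliding [e] over [f] need not give a reduced
     tree; but [f'] has stabilizer [G_v], and [e] is slid over [f']. *)
  pose f' := eact s^-1 (bar f).
  have of' : origin e = origin f'.
    by rewrite origin_eact -/(terminus f) tf vactK.
  have tf' : terminus f' = vact s^-1 (origin f) by rewrite terminus_eact terminus_bar.
  have sv : vstab (origin e) `<=` estab f'.
    move=> x xv; apply/estab_act; rewrite estab_bar; apply/sub/ue.
    by rewrite tf -oef; apply/vstab_act; rewrite invgK conjK.
  apply: (ascending_not_rigid (e := e) (f := f') rT) rigT => //.
  - by apply: subset_trans sv; apply: estab_origin.
  - by move=> g; rewrite /f' -eactM.
  - by move=> g; rewrite /f' bar_eact barK -eactM.
  - by rewrite -of'.
  rewrite -of' tf' => uv.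
  have [|g] := (reducedP T).1 rT (bar e).
    rewrite terminus_bar estab_bar => x xv; apply: ue.
    rewrite tf; apply/vstab_act; rewrite -oef; apply/uv/vstab_act.
    by rewrite invgK conjV -oef.
  rewrite terminus_bar -/(terminus e) => E.
  by apply: (nloop g^-1); rewrite E vactK.
(* Alternative (3) is what remains: [G_f = G_v] forces [f] to be a loop of the quotient, and [f'] is
   its reversed translate at [v]. *)
have [|t] := (reducedP T).1 rT (bar f); first by rewrite terminus_bar estab_bar.
rewrite terminus_bar -/(terminus f) => vE.
pose f' := eact t (bar f).
have of' : origin f' = v by rewrite origin_eact -/(terminus f) -vE.
have uv : vstab (terminus f) `<=` vstab (origin f).
  apply: contrapT => nuv.
  exact: (ascending_not_rigid rT oef sub nef nefb nloop sf nuv rigT).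
have sfv : estab f = vstab v.
  by apply/seteqP; rewrite -of_; split=> //; apply: estab_origin.
have sfv' : estab f' = vstab v.
  apply/seteqP; split=> [|x xv]; first by rewrite -of'; apply: estab_origin.
  apply/estab_act; rewrite estab_bar; apply/sf/uv.
  by apply/vstab_act; rewrite -vE of_.
(* A further edge [h] contradicts rigidity: if it is a loop of the quotient it is slid over [f], and
   otherwise it detects the slide of [e]. *)
have three h : origin h = v ->
    [\/ exists g, h = eact g e, exists g, h = eact g f | exists g, h = eact g f'].
  move=> oh; apply: contrapT => nh.
  have nhe g : h <> eact g e by move=> E; apply: nh; apply: Or31; exists g.
  have nhf g : h <> eact g f by move=> E; apply: nh; apply: Or32; exists g.
  have nhfb g : h <> eact g (bar f).
    by move=> E; apply: nh; apply: Or33; exists (g * t^-1); rewrite eactM eactK.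
  have ohf : origin h = origin f by rewrite of_.
  have sub_hf : estab h `<=` estab f by rewrite sfv -oh; apply: estab_origin.
  have [[g th]|nlooph] := pselect (exists g, terminus h = vact g (origin h)).
    apply: (loop_not_rigid (oef := ohf) (sub_ef := sub_hf) (nef := nhf) (nefb := nhfb)) rigT.
      by exists g.
    apply: slide_reduced => //; left; exists (g * t).
    by rewrite vactM -vE th ohf.
  apply: (third_edge_not_rigid rT oef sub nef nefb nloop sf ohf nhe nhf) rigT.
  by move=> g E; apply: nlooph; exists g.
have orbits : local_orbits v = [set local_orbit v e; local_orbit v f; local_orbit v f'].
  apply/seteqP; split=> [_ [h oh <-]|_ [[->|->]|->]]; last first.
  - by exists f'.
  - by exists f.
  - by exists e.
  have [[g E]|[g E]|[g E]] := three h oh.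
  - by left; left; apply/esym/local_orbit_eq => //; exists g.
  - by left; right; apply/esym/local_orbit_eq => //; exists g.
  - by right; apply/esym/local_orbit_eq => //; exists g.
apply: Or33; exists f'; split=> //.
- by apply/esym/eorbit_eq; exists t.
- by rewrite sfv sfv'.
rewrite orbits; apply: card_three => /local_orbit_eq.
- by move=> /(_ oe of_).
- move=> /(_ oe of') [g E]; apply: (@nefb (g^-1 * t)).
  by rewrite eactM -/f' E eactK.
- by move=> /(_ of_ of') [g /esym/not_inverted].
Qed.

End Main.

Theorem theorem1 (G : groupType) (T : gtree G)
    (hred : reduced T) (hcoc : cocompact T) (hHNN : ~ ascending_HNN T) :
  rigid T <->
  forall (v : vertex T) (e f : edge T),
    origin e = v -> origin f = v -> estab e `<=` estab f ->
    [\/ local_orbit v e = local_orbit v f,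
        eorbit e = eorbit (bar f) /\ estab e = estab f
      | exists f' : edge T,
          [/\ origin f' = v,
              eorbit f' = eorbit (bar f),
              estab f = estab f' /\ estab f' = vstab v,
              local_orbits v =
                [set local_orbit v e; local_orbit v f; local_orbit v f'] &
              (local_orbits v #= `I_3)%card]].
Proof.
split=> [rigT|]; last exact: rigid_of_condition.
exact: condition_of_rigid hred hcoc.1 hHNN rigT.
Qed.
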